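(* Let $G$ be a double-critical, $t$-chromatic graph with $t \in \{6, 7, 8\}$. If $G$ is claw-free, then $G = K_t$ (that is, $G$ is isomorphic to the complete graph on $t$ vertices).
   Context: All graphs are finite, without loops or multiple edges. $\chi(G)$ denotes the chromatic number of $G$; $G$ is $t$-chromatic if $\chi(G) = t$. For $A \subseteq V(G)$, $G \setminus A$ is the subgraph of $G$ induced on $V(G) \setminus A$. A connected graph $G$ is double-critical if for every edge $xy \in E(G)$, $\chi(G \setminus \{x, y\}) = \chi(G) - 2$. A graph is claw-free if it does not contain $K_{1,3}$ as an induced subgraph. *)

(* Defs.v *)
From mathcomp Require Import all_boot.
Set Implicit Arguments.
Unset Strict Implicit.
Unset Printing Implicit Defensive.

Record sgraph := SGraph {
  vertex :> finType;
  adj : rel vertex;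
  adj_sym : symmetric adj;
  adj_irrefl : irreflexive adj
}.

Definition isomorphic (G H : sgraph) : Prop :=
  exists2 f : G -> H, bijective f & forall x y, adj (f x) (f y) = adj x y.

Section Induced.
Variables (G : sgraph) (A : {set G}).

Definition induced_adj : rel {x : G | x \in A} := fun u v => adj (val u) (val v).

Lemma induced_adj_sym : symmetric induced_adj.
Proof. by move=> u v; apply: adj_sym. Qed.

Lemma induced_adj_irrefl : irreflexive induced_adj.
Proof. by move=> u; apply: adj_irrefl. Qed.

Definition induced : sgraph := SGraph induced_adj_sym induced_adj_irrefl.
End Induced.

Definition delete (G : sgraph) (A : {set G}) : sgraph := induced (~: A).

Definition complete_adj n : rel 'I_n := fun i j => i != j.

Lemma complete_adj_sym n : symmetric (@complete_adj n).
Proof. by move=> i j; rewrite /complete_adj eq_sym. Qed.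

Lemma complete_adj_irrefl n : irreflexive (@complete_adj n).
Proof. by move=> i; rewrite /complete_adj eqxx. Qed.

Definition complete_graph n : sgraph :=
  SGraph (@complete_adj_sym n) (@complete_adj_irrefl n).

Definition biclique_adj m n : rel ('I_m + 'I_n) := fun u v =>
  match u, v with
  | inl _, inr _ | inr _, inl _ => true
  | _, _ => false
  end.

Lemma biclique_adj_sym m n : symmetric (@biclique_adj m n).
Proof. by case=> i [] j. Qed.

Lemma biclique_adj_irrefl m n : irreflexive (@biclique_adj m n).
Proof. by case. Qed.

Definition complete_bipartite m n : sgraph :=
  SGraph (@biclique_adj_sym m n) (@biclique_adj_irrefl m n).

Definition colorable (G : sgraph) (k : nat) : bool :=
  [exists c : {ffun G -> 'I_k}, [forall x, forall y, adj x y ==> (c x != c y)]].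

Lemma ex_colorable (G : sgraph) : exists k, colorable G k.
Proof.
exists #|G|; apply/existsP; exists [ffun x => enum_rank x].
apply/forallP=> x; apply/forallP=> y; apply/implyP=> exy; rewrite !ffunE.
by apply/negP=> /eqP/enum_rank_inj eq_xy; rewrite eq_xy adj_irrefl in exy.
Qed.

Definition chromatic_number (G : sgraph) : nat := ex_minn (ex_colorable G).

Definition connected (G : sgraph) : Prop := forall x y : G, connect (@adj G) x y.

(* As an edge forces chromatic number at least 2, adding 2 on the left is the
   same as subtracting it on the right, without truncated subtraction. *)
Definition double_critical (G : sgraph) : Prop :=
  connected G /\
  forall x y : G, adj x y ->
    chromatic_number (delete [set x; y]) + 2 = chromatic_number G.

Definition claw_free (G : sgraph) : Prop :=
  ~ exists A : {set G}, isomorphic (induced A) (complete_bipartite 1 3).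

(* Main.v *)
(** A claw-free double-critical [G] that is not complete has no three pairwise
    nonadjacent vertices in a neighbourhood [N(x)], so a colour class meets
    [N(x)] in at most two vertices. With m = t - 2, colouring [G] minus an edge
    far from [x] gives d(x) <= 2m - 2, while Kempe-type arguments give
    d(x) >= m + 3; this settles t = 6. A local analysis excludes d(x) = m + 3
    for t = 7 and t = 8, so that t = 7 is impossible and for t = 8 the graph is
    10-regular, each vertex of [N(x)] having two or three nonneighbours in [N(x)].

    The case t = 8 is an extremal argument on cliques [T] that are as symmetric
    as the two ends of an edge: all but 8 - #|T| of the six colour classes of
    [G \ T] contain no neighbour of [T], so the vertices of [T] may be permuted
    among these classes and the spare colours. Each vertex of [T] has one or two
    neighbours in every other class, and exactly 5 - #|T| classes where it has a
    single one. Since there is no K_7, the single neighbours of the vertices of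
    [T] tend to coincide, and a common one can be added to [T]. Thus #|T| grows
    from 2 to 5, where every class holds two neighbours of every vertex of [T]
    and a count of nonadjacent pairs is contradictory. *)
Require Import Defs.
From mathcomp Require Import all_boot zify.
Set Implicit Arguments.
Unset Strict Implicit.
Unset Printing Implicit Defensive.

(** The Kempe-type arguments give two facts about vertices [x] and [y] of a symmetric clique. Every
    class seen by the clique contains a common neighbour of [x] and [y]; and for two different such
    classes some path of length three from [x] to [y] runs through the first and then the second.
    Otherwise a recolouring would colour [G] with t - 1 colours. Hence a single neighbour of one
    vertex is adjacent to the whole clique, and single neighbours of two vertices in different
    classes are adjacent to each other: this is how a K_7 would arise.

    The bound m + 3 counts m common neighbours of [x] and a neighbour [y], the vertex [y] itself,
    and two neighbours of [x] nonadjacent to [y].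

    The obstacle to enlarging the clique is that a common single neighbour [u] may have neighbours
    in the spare colours. So a vertex of the clique is first moved into a spare class and replaced
    by [u]. If the spare colour becomes single for [u], then [u] has no other neighbour of that
    colour. *)

Definition nbr (G : sgraph) (x : G) : {set G} := [set v | adj x v].

(** For [v] adjacent to [x], this is the neighbourhood of [v] in the complement of the graph induced
    on the neighbours of [x]. *)
Definition nonnbr (G : sgraph) (x v : G) : {set G} :=
  [set w in nbr x | (w != v) && ~~ adj v w].

(** Colourings are total functions with free values on [T], so that deleting vertices needs no
    subtype. The type of colours varies: it will also be [option 'I_m] or the set of vertices of a
    clique. *)
Definition proper_off (G : sgraph) (T : {set G}) (D : eqType) (c : G -> D) :=
  forall u v, u \notin T -> v \notin T -> adj u v -> c u != c v.

Definition clique (G : sgraph) (K : {set G}) :=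
  forall u v, u \in K -> v \in K -> u != v -> adj u v.

Definition no_claw (G : sgraph) :=
  forall x a b c : G, adj x a -> adj x b -> adj x c ->
  a != b -> a != c -> b != c -> [|| adj a b, adj a c | adj b c].

Definition recolor (G : sgraph) (D : Type) (c : G -> D) (S : {set G}) (i : D) : G -> D :=
  fun v => if v \in S then i else c v.

(* [C] is the set of classes in which [T] has neighbours. The other colours are
   as many as #|T| - 2, and any #|T| - 2 vertices of [T] can be given them. *)
Definition config (G : sgraph) m (T : {set G}) (c : G -> 'I_m) (C : {set 'I_m}) :=
  [/\ clique T, proper_off T c,
      forall x v, x \in T -> v \notin T -> adj x v -> c v \in C
    & #|T| + #|C| = m.+2].

Definition cls (G : sgraph) m (T : {set G}) (c : G -> 'I_m) (x : G) (i : 'I_m) :=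
  [set v in nbr x | (v \notin T) && (c v == i)].

Definition singles (G : sgraph) m (T : {set G}) (c : G -> 'I_m) (C : {set 'I_m}) x :=
  [set i in C | #|cls T c x i| == 1].

Lemma adjC (G : sgraph) (x y : G) : adj x y = adj y x.
Proof. exact: adj_sym. Qed.

Lemma adj_neq (G : sgraph) (x y : G) : adj x y -> x != y.
Proof. by move=> xy; apply/eqP => E; rewrite E adj_irrefl in xy. Qed.

Lemma nonnbrP (G : sgraph) (x v w : G) :
  reflect [/\ adj x w, w != v & ~~ adj v w] (w \in nonnbr x v).
Proof. by rewrite !inE; apply: (iffP and3P). Qed.

Lemma nonnbr_sym (G : sgraph) (x v w : G) :
  adj x v -> w \in nonnbr x v -> v \in nonnbr x w.
Proof.
by move=> xv /nonnbrP[xw wv vw]; apply/nonnbrP; split; rewrite // 1?eq_sym // adjC.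
Qed.

Lemma size_uniq_leq_card (T : finType) (A : {set T}) (s : seq T) :
  uniq s -> {subset s <= A} -> size s <= #|A|.
Proof.
move=> us sA; rewrite cardE; apply: uniq_leq_size => // x /sA.
by rewrite mem_enum.
Qed.

Lemma set2_eq (T : finType) (A : {set T}) x y :
  x \in A -> y \in A -> x != y -> #|A| <= 2 -> A = [set x; y].
Proof.
move=> xA yA xy A2; apply/esym/eqP.
by rewrite eqEcard cards2 xy A2 subUset !sub1set xA yA.
Qed.

Lemma exists_outside (T : finType) (A B1 B2 : {set T}) :
  #|B1| + #|B2| < #|A| -> exists z, [/\ z \in A, z \notin B1 & z \notin B2].
Proof.
move=> lt; have /subsetPn[z zA] : ~~ (A \subset B1 :|: B2).
  apply: contraL lt => /subset_leq_card AB; rewrite -leqNgt.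
  exact: leq_trans AB (leq_card_setU B1 B2).
by rewrite inE negb_or => /andP[? ?]; exists z.
Qed.

(** The deleted set shrinks by [S], so a chain of recolourings can end with a colouring of the whole
    graph. *)
Lemma recolor_proper (G : sgraph) (D : eqType) (T S : {set G}) (c : G -> D) i :
  proper_off T c -> (forall u v, u \in S -> v \in S -> ~~ adj u v) ->
  (forall u v, u \in S -> v \notin T -> v \notin S -> c v = i -> ~~ adj u v) ->
  proper_off (T :\: S) (recolor c S i).
Proof.
move=> pr S_indep S_free u v; rewrite !inE !negb_and !negbK /recolor => uT vT uv.
have [uS|uS] := boolP (u \in S); have [vS|vS] := boolP (v \in S).
- by have := S_indep _ _ uS vS; rewrite uv.
- apply/eqP => E; rewrite (negbTE vS) in vT.
  by have := S_free _ _ uS vT vS (esym E); rewrite uv.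
- apply/eqP => E; rewrite (negbTE uS) in uT.
  by have := S_free _ _ vS uT uS E; rewrite adjC uv.
- by apply: pr; [move: uT; rewrite (negbTE uS)|move: vT; rewrite (negbTE vS)|].
Qed.

(** * Kempe changes *)

Section Kempe.
Variables (G : sgraph) (m : nat).
Implicit Types (T : {set G}) (c : G -> 'I_m) (C : {set 'I_m}).

Lemma config_drop T c C z i :
  config T c C -> z \in T -> i \notin C ->
  config (T :\ z) (recolor c [set z] i) (i |: C).
Proof.
move=> [cl pr nb cd] zT iC; split.
- by move=> u v /setD1P[_ uT] /setD1P[_ vT]; apply: cl.
- apply: recolor_proper => // [u v /set1P-> /set1P->|u v /set1P-> vT _ cv].
    by rewrite adj_irrefl.
  by apply: contraNN iC => /(nb _ _ zT vT); rewrite cv.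
- move=> x v /setD1P[xz xT]; rewrite in_setD1 negb_and negbK /recolor in_setU1 in_set1.
  have [->|vz] /= := eqVneq v z; first by rewrite eqxx.
  by move=> vT /(nb _ _ xT vT) ->; rewrite orbT.
- by rewrite cardsU1 iC -cd (cardsD1 z T) zT; lia.
Qed.

Lemma config_free T c C : config T c C -> 2 < #|T| -> exists i, i \notin C.
Proof.
move=> [_ _ _ cd] T2; have : #|~: C| > 0 by have := cardsC C; rewrite card_ord; lia.
by case/card_gt0P=> i; rewrite inE => iC; exists i.
Qed.

(** The enlarged clique no longer sees class [i]: [u] was the only neighbour of [T] there, and [u]
    has no neighbour of its own colour. *)
Lemma config_add T c C u i :
  config T c C -> u \notin T -> i \in C -> (forall x, x \in T -> cls T c x i = [set u]) ->
  (forall v, adj u v -> v \notin T -> c v \in C) ->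
  config (u |: T) c (C :\ i).
Proof.
move=> [cl pr nb cd] uT iC uX un.
have Tu x : x \in T -> adj x u && (c u == i).
  by move=> /uX/setP/(_ u); rewrite !inE eqxx uT /= => ->.
have xi x v : x \in T -> v \notin T -> adj x v -> c v = i -> v = u.
  by move=> xT vT xv cv; apply/set1P; rewrite -(uX x xT) !inE xv vT cv eqxx.
split.
- move=> v w /setU1P[->|vT] /setU1P[->|wT]; last exact: cl.
  + by rewrite eqxx.
  + by rewrite adjC => _; case/andP: (Tu w wT).
  + by move=> _; case/andP: (Tu v vT).
- by move=> v w; rewrite !inE !negb_or => /andP[_ vT] /andP[_ wT]; apply: pr.
- move=> x v xT; rewrite !inE negb_or => /andP[vu vT] xv; apply/andP; split.
    apply/eqP => cv; case/setU1P: xT => [E|xT]; last first.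
      by move/eqP: vu; apply; apply: (xi x).
    have /card_gt0P[y yT] : 0 < #|T| by have := subset_leq_card (subsetT C);
        rewrite cardsT card_ord; lia.
    have /andP[_ /eqP cu] := Tu y yT.
    have vu' : adj u v by rewrite -E.
    by have := pr u v uT vT vu'; rewrite cu cv eqxx.
  by case/setU1P: xT => [E|xT]; [apply: un => //; rewrite -E | apply: (nb x)].
- by rewrite cardsU1 uT -cd (cardsD1 i C) iC; lia.
Qed.

Hypothesis uncolorable :
  forall (D : finType) (f : G -> D), #|D| <= m.+1 -> ~ proper_off set0 f.

(* If the alternating path were missing, shifting colours along it would free
   a colour for [x]: [x] gets [i], its neighbours coloured [i] get [j], the
   neighbours of those coloured [j] get the extra colour [None] of [y]. *)
Lemma kempe2_edge c (x y : G) i j :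
  adj x y -> proper_off [set x; y] c -> i != j ->
  exists u, exists v, [/\ u \notin [set x; y], v \notin [set x; y],
     adj x u, adj u v & adj v y] /\ c u = i /\ c v = j.
Proof.
move=> xy pr ij; pose A := cls [set x; y] c x i.
pose B := [set v | (v \notin [set x; y]) && (c v == j) && [exists u in A, adj u v]].
have [/existsP[v /andP[]]|no] := boolP [exists v in B, adj v y].
  rewrite inE => /andP[/andP[vT /eqP cv] /existsP[u /andP[]]].
  by rewrite inE => /and3P[]; rewrite inE => xu uT /eqP cu uv vy; exists u, v.
exfalso; apply: (@uncolorable (option 'I_m)
    (recolor (recolor (recolor (Some \o c) (y |: B) None) A (Some j)) [set x] (Some i))).
  by rewrite card_option card_ord.
have AT v : v \in A -> [/\ v \notin [set x; y], adj x v & c v = i].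
  by rewrite inE => /and3P[]; rewrite inE => ? ? /eqP.
have BT v : v \in B -> v \notin [set x; y] /\ c v = j.
  by rewrite inE => /andP[/andP[? /eqP]].
have -> : set0 = [set x; y] :\: (y |: B) :\: A :\: [set x] :> {set G}.
  by apply/esym/setP => v; rewrite !inE; case: eqP => //= _; case: eqP; rewrite ?andbF.
apply: recolor_proper; first (apply: recolor_proper; first apply: recolor_proper).
- by move=> u v uT vT uv; apply: contra_neq (pr _ _ uT vT uv) => -[].
- have By v : v \in B -> ~~ adj v y.
    by move=> vB; apply: contraNN no => vy; apply/existsP; exists v; rewrite vB.
  move=> u v /setU1P[->|uB] /setU1P[->|vB]; rewrite ?adj_irrefl ?By //.
    by rewrite adjC By.
  have [[uT cu] [vT cv]] := (BT _ uB, BT _ vB).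
  by apply/negP => /(pr _ _ uT vT); rewrite cu cv eqxx.
- by [].
- move=> u v /AT[uT _ cu] /AT[vT _ cv].
  by apply/negP => /(pr _ _ uT vT); rewrite cu cv eqxx.
- move=> u v uA; rewrite inE /recolor; case: ifP => // nB /= vT _ [cv].
  apply/negP => uv; move/negbT: nB; rewrite in_setU1 negb_or inE => /andP[_].
  by rewrite vT cv eqxx => /negP; apply; apply/existsP; exists u; rewrite uA.
- by move=> u v /set1P-> /set1P->; rewrite adj_irrefl.
- move=> u v /set1P-> _; rewrite /recolor in_set1 => vx.
  case: ifP => [_ []/eqP|vA]; first by rewrite eq_sym (negbTE ij).
  case: ifP => // vB [cv]; apply/negP => xv; move: vA vB; rewrite !inE xv cv eqxx.
  by rewrite (negbTE vx) andbT /=; case: eqP.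
Qed.

(** Without such a vertex, [y] and the neighbours of [x] coloured [i] would be independent. They
    could share the extra colour [None], which frees [i] for [x]. *)
Lemma kempe1_edge c (x y : G) i :
  adj x y -> proper_off [set x; y] c ->
  exists u, [/\ u \notin [set x; y], adj x u, adj y u & c u = i].
Proof.
move=> xy pr.
have [/existsP[u /and4P[uT xu yu /eqP cu]]|no] := boolP [exists u,
  [&& u \notin [set x; y], adj x u, adj y u & c u == i]]; first by exists u.
exfalso; apply: (@uncolorable (option 'I_m)
    (recolor (recolor (Some \o c) (y |: cls [set x; y] c x i) None) [set x] (Some i))).
  by rewrite card_option card_ord.
have -> : set0 = [set x; y] :\: (y |: cls [set x; y] c x i) :\: [set x] :> {set G}.
  by apply/esym/setP => v; rewrite !inE; case: eqP => //= _; case: eqP; rewrite ?andbF.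
have ST v : v \in cls [set x; y] c x i -> [/\ v \notin [set x; y], ~~ adj y v & c v = i].
  rewrite inE => /and3P[]; rewrite inE => xv vT /eqP cv; split=> //.
  by apply: contraNN no => yv; apply/existsP; exists v; rewrite vT xv yv cv eqxx.
apply: recolor_proper; first apply: recolor_proper.
- by move=> u v uT vT uv; apply: contra_neq (pr _ _ uT vT uv) => -[].
- move=> u v /setU1P[->|/ST[uT yu cu]] /setU1P[->|/ST[vT yv cv]]; rewrite ?adj_irrefl //.
    by rewrite adjC.
  by apply/negP => /(pr _ _ uT vT); rewrite cu cv eqxx.
- by [].
- by move=> u v /set1P-> /set1P->; rewrite adj_irrefl.
- move=> u v /set1P-> _; rewrite /recolor in_set1 => vx.
  case: ifP => // vB [cv]; apply/negP => xv; move: vB; rewrite !inE xv cv eqxx.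
  by rewrite (negbTE vx) andbT /=; case: eqP.
Qed.

Lemma config_edge T c C x y :
  config T c C -> x \in T -> y \in T -> x != y ->
  exists2 c', proper_off [set x; y] c' &
  forall v, v \notin [set x; y] -> c' v \in C -> v \notin T /\ c v = c' v.
Proof.
have [n] := ubnP #|T|; elim: n T c C => // n IH T c C Tn cf xT yT xy.
have [T2|T2] := leqP #|T| 2.
  have E := set2_eq xT yT xy T2; exists c; first by rewrite -E; case: cf.
  by move=> v vT _; rewrite E.
have [i iC] := config_free cf T2.
have /card_gt0P[z /setDP[zT]] : 0 < #|T :\: [set x; y]|.
  by rewrite -subn_gt0 in T2; rewrite cardsD (leq_trans T2) // leq_sub2l // (leq_trans
      (subset_leq_card (subsetIr _ _))) // cards2 xy.
rewrite !inE negb_or => /andP[zx zy].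
have [||||c' pr' c'P] := IH _ _ _ _ (config_drop cf zT iC);
    rewrite ?inE ?xT ?yT ?(eq_sym _ z) ?zx ?zy //.
  by move: Tn; rewrite (cardsD1 z T) zT.
exists c' => // v vxy vC; have := c'P v vxy; rewrite !inE vC orbT => /(_ isT) [].
rewrite negb_and negbK /recolor in_set1; case: eqP => //= _ _ E.
by rewrite -E (negbTE iC) in vC.
Qed.

Lemma kempe1 T c C x y i :
  config T c C -> x \in T -> y \in T -> x != y -> i \in C ->
  exists u, u \in cls T c x i /\ u \in cls T c y i.
Proof.
move=> cf xT yT xy iC; have [c' pr c'P] := config_edge cf xT yT xy.
have [cl _ _ _] := cf; have [u [uT xu yu cu]] := kempe1_edge i (cl _ _ xT yT xy) pr.
have [//||uT' E] := c'P u; first by rewrite cu.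
by exists u; rewrite !inE xu yu uT' E cu eqxx.
Qed.

Lemma kempe2 T c C x y i j :
  config T c C -> x \in T -> y \in T -> x != y -> i \in C -> j \in C -> i != j ->
  exists u v, [/\ u \in cls T c x i, v \in cls T c y j & adj u v].
Proof.
move=> cf xT yT xy iC jC ij; have [c' pr c'P] := config_edge cf xT yT xy.
have [cl _ _ _] := cf.
have [u [v [[uT vT xu uv vy] [cu cv]]]] := kempe2_edge (cl _ _ xT yT xy) pr ij.
have [//||uT' Eu] := c'P u; first by rewrite cu.
have [//||vT' Ev] := c'P v; first by rewrite cv.
by exists u, v; rewrite !inE xu uT' Eu cu (adjC y) vy vT' Ev cv !eqxx.
Qed.

End Kempe.

(** * Neighbours in a colour class *)

Section Classes.
Variables (G : sgraph) (m : nat).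
Hypothesis uncolorable :
  forall (D : finType) (f : G -> D), #|D| <= m.+1 -> ~ proper_off set0 f.
Hypothesis claw : no_claw G.
Implicit Types (T : {set G}) (c : G -> 'I_m) (C : {set 'I_m}) (x y a b d u v w : G) (i j :
    'I_m).

Lemma nonnbr_triangle x a b d :
  adj x d -> a \in nonnbr x d -> b \in nonnbr x d -> b \in nonnbr x a -> False.
Proof.
move=> xd /nonnbrP[xa ad da] /nonnbrP[xb bd db] /nonnbrP[_ ba ab].
have := claw xd xa xb; rewrite !(eq_sym d) (eq_sym a b) ad bd ba.
by rewrite (negbTE da) (negbTE db) (negbTE ab) => /(_ isT isT isT).
Qed.

Lemma clsP T c x i v :
  reflect [/\ adj x v, v \notin T & c v = i] (v \in cls T c x i).
Proof.
rewrite !inE; apply: (iffP and3P) => -[? ? H]; split=> //; last by rewrite H.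
exact/eqP.
Qed.

Lemma cls_nonadj T c C x y i u v :
  config T c C -> u \in cls T c x i -> v \in cls T c y i -> ~~ adj u v.
Proof.
move=> [_ pr _ _] /clsP[_ uT cu] /clsP[_ vT cv].
by apply/negP => /(pr _ _ uT vT); rewrite cu cv eqxx.
Qed.

Lemma mem_cls_of_adj T c x y i v :
  y \in T -> v \in cls T c x i -> adj y v -> v \in cls T c y i.
Proof. by move=> yT /clsP[_ vT cv] yv; apply/clsP. Qed.

Lemma cls_mate T c C x i u v :
  config T c C -> u \in cls T c x i -> v \in cls T c x i -> v != u ->
  v \in nonnbr x u.
Proof.
move=> cf uX vX vu; apply/nonnbrP; split=> //; first by case/clsP: vX.
exact: cls_nonadj cf uX vX.
Qed.

Lemma cls_le2 T c C x i : config T c C -> #|cls T c x i| <= 2.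
Proof.
move=> cf; rewrite leqNgt; apply/negP => /card_gt2P[u [v [w [uvw [uv vw wu]]]]].
have [uX vX wX] := uvw.
have /clsP[xu _ _] := uX; have /clsP[xv _ _] := vX; have /clsP[xw _ _] := wX.
have := claw xu xv xw uv; rewrite eq_sym wu vw.
rewrite (negbTE (cls_nonadj cf uX vX)) (negbTE (cls_nonadj cf uX wX)).
by rewrite (negbTE (cls_nonadj cf vX wX)) => /(_ isT isT).
Qed.

Lemma config_gt1 T c C : config T c C -> 1 < #|T|.
Proof.
case=> _ _ _; have := subset_leq_card (subsetT C).
rewrite cardsT card_ord; lia.
Qed.

Lemma config_other T c C x : config T c C -> exists2 y, y \in T & y != x.
Proof.
move=> /config_gt1; rewrite (cardsD1 x) => T1.
have /card_gt0P[y /setD1P[yx yT]] : 0 < #|T :\ x| by move: T1; case: (x \in T) => /=; lia.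
by exists y.
Qed.

Lemma cls_gt0 T c C x i : config T c C -> x \in T -> i \in C -> 0 < #|cls T c x i|.
Proof.
move=> cf xT iC; have [y yT yx] := config_other x cf; rewrite eq_sym in yx.
by have [u [uX _]] := kempe1 uncolorable cf xT yT yx iC; apply/card_gt0P; exists u.
Qed.

Lemma mem_nbr T c C x v :
  config T c C -> x \in T -> adj x v -> v \notin T -> c v \in C /\ v \in cls T c x (c v).
Proof.
by move=> [_ _ nb _] xT xv vT; split; [apply: nb xv | apply/clsP].
Qed.

Lemma cls_two T c C x i u v w :
  config T c C -> u \in cls T c x i -> v \in cls T c x i -> u != v ->
  w \in cls T c x i -> w = u \/ w = v.
Proof.
move=> cf uX vX uv wX; have := set2_eq uX vX uv (cls_le2 x i cf).
by move=> E; move: wX; rewrite E !inE => /orP[]/eqP; [left|right].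
Qed.

Lemma singlesC T c C x i : i \in singles T c C x -> i \in C.
Proof. by rewrite inE => /andP[]. Qed.

Lemma single_eq T c C x i u v :
  i \in singles T c C x -> u \in cls T c x i -> v \in cls T c x i -> u = v.
Proof. by rewrite inE => /andP[_ /cards1P[w ->]] /set1P-> /set1P->. Qed.

Lemma single_set T c C x i u :
  i \in singles T c C x -> u \in cls T c x i -> cls T c x i = [set u].
Proof. by rewrite inE => /andP[_ /cards1P[w ->]] /set1P->. Qed.

Lemma single_common T c C x y i u :
  config T c C -> x \in T -> y \in T -> i \in singles T c C x ->
  u \in cls T c x i -> u \in cls T c y i.
Proof.
move=> cf xT yT iS uX; have [->//|yx] := eqVneq y x; rewrite eq_sym in yx.
have [v [vX vY]] := kempe1 uncolorable cf xT yT yx (singlesC iS).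
by rewrite (single_eq iS uX vX).
Qed.

Lemma single_link T c C x y i j u v :
  config T c C -> x \in T -> y \in T -> x != y -> i != j ->
  i \in singles T c C x -> j \in singles T c C y ->
  u \in cls T c x i -> v \in cls T c y j -> adj u v.
Proof.
move=> cf xT yT xy ij iS jS uX vY.
have [u' [v' [u'X v'Y]]] := kempe2 uncolorable cf xT yT xy (singlesC iS) (singlesC jS) ij.
by rewrite (single_eq iS u'X uX) (single_eq jS v'Y vY).
Qed.

Lemma not_single T c C x i u :
  config T c C -> i \in C -> i \notin singles T c C x -> u \in cls T c x i ->
  exists2 v, v \in cls T c x i & v != u.
Proof.
move=> cf iC iS uX; have : 1 < #|cls T c x i|.
  have : 0 < #|cls T c x i| by apply/card_gt0P; exists u.
  by move: iS; rewrite inE iC /=; case: #|_| => [|[]].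
by case/card_gt1P=> a [b [aX bX ab]]; have [E|] := eqVneq a u; [exists b;
    rewrite // -E eq_sym|exists a].
Qed.

Lemma single_of_not_adj T c C x y i u :
  config T c C -> x \in T -> y \in T -> i \in C -> u \in cls T c x i -> ~~ adj y u ->
  i \notin singles T c C x.
Proof.
move=> cf xT yT iC uX; apply: contraNN => iS.
by have /clsP[] := single_common cf xT yT iS uX.
Qed.

Lemma card_nbr T c C x : config T c C -> x \in T ->
  #|nbr x| = #|T|.-1 + \sum_(i in C) #|cls T c x i|.
Proof.
move=> cf xT; have [cl pr nb _] := cf; rewrite -(cardsID T); congr (_ + _).
  rewrite (cardsD1 x T) xT /=; apply: eq_card => v; rewrite !inE.
  have [->|vx] := eqVneq v x; first by rewrite adj_irrefl.
  by case vT: (v \in T) => //=; rewrite ?andbF // andbT cl // eq_sym.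
rewrite -sum1_card (partition_big c (mem C)) /=; last first.
  by move=> v; rewrite !inE => /andP[vT xv]; apply: nb xv.
apply: eq_bigr => i iC; rewrite sum1_card; apply: eq_card => v.
by rewrite !inE unfold_in /= !inE andbA (andbC (v \notin T)).
Qed.

(** Each class of [C] holds one or two neighbours of [x]; one extra unit per single class makes
    every class count two. *)
Lemma card_singles T c C x : config T c C -> x \in T ->
  #|singles T c C x| + #|nbr x| + 1 = 2 * #|C| + #|T|.
Proof.
move=> cf xT; rewrite (card_nbr cf xT).
have -> : #|singles T c C x| = \sum_(i in C) (#|cls T c x i| == 1).
  by rewrite -sum1_card big_mkcond [RHS]big_mkcond; apply: eq_bigr => i _; rewrite inE;
      case: (i \in C) => //=; case: eqP.
have : \sum_(i in C) ((#|cls T c x i| == 1) + #|cls T c x i|) = \sum_(i in C) 2.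
  apply: eq_bigr => i iC; have := cls_gt0 cf xT iC; have := cls_le2 x i cf.
  by case: #|_| => [|[|[]]].
rewrite big_split sum_nat_const /=; have := config_gt1 cf; lia.
Qed.

Lemma nonnbr_cls T c C x y w :
  config T c C -> x \in T -> y \in T -> w \in nonnbr x y ->
  exists2 i, i \in C & w \in cls T c x i.
Proof.
move=> cf xT yT /nonnbrP[xw wy yw]; case: (cf) => cl _ _ _.
have wT : w \notin T by apply: contraNN yw => wT; apply: cl; rewrite // eq_sym.
by have [cw wX] := mem_nbr cf xT xw wT; exists (c w).
Qed.

(* Each class holds at most two neighbours of [x], one of them adjacent to [y]. *)
Lemma nonnbr_cls_inj T c C x y i u v :
  config T c C -> x \in T -> y \in T -> x != y -> i \in C ->
  u \in nonnbr x y -> v \in nonnbr x y -> u \in cls T c x i -> v \in cls T c x i -> u = v.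
Proof.
move=> cf xT yT xy iC /nonnbrP[_ _ yu] /nonnbrP[_ _ yv] uX vX.
have [a [aX /clsP[ya _ _]]] := kempe1 uncolorable cf xT yT xy iC.
apply/eqP; apply: contraTT ya => uv.
by have [->|->] := cls_two cf uX vX uv aX.
Qed.

End Classes.

(** * The 10-regular case *)

Section Regular.
Variable G : sgraph.
Hypothesis uncolorable :
  forall (D : finType) (f : G -> D), #|D| <= 7 -> ~ proper_off set0 f.
Hypothesis claw : no_claw G.
Hypothesis regular : forall x : G, #|nbr x| = 10.
Hypothesis nonnbr_bounds : forall x y : G, adj x y -> 1 < #|nonnbr x y| <= 3.
Hypothesis no_K7 : forall K : {set G}, clique K -> #|K| <= 6.
Implicit Types (T : {set G}) (c : G -> 'I_6) (C : {set 'I_6}) (x y a b d u v w : G) (i j :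
    'I_6).

Lemma nonnbr_le3 x v (s : seq G) :
  adj x v -> uniq s -> all (fun u => u \in nonnbr x v) s -> size s <= 3.
Proof.
move=> xv us /allP sN; apply: leq_trans (size_uniq_leq_card us sN) _.
by case/andP: (nonnbr_bounds xv).
Qed.

Lemma nonnbr_full x v a b d w :
  adj x v -> uniq [:: a; b; d] -> a \in nonnbr x v -> b \in nonnbr x v ->
  d \in nonnbr x v -> w \in nonnbr x v -> w \in [:: a; b; d].
Proof.
move=> xv us av bv dv wv; apply: contraT => wn.
have := @nonnbr_le3 x v [:: w, a, b, d & [::]] xv.
by rewrite cons_uniq wn us /= av bv dv wv => /(_ isT isT).
Qed.

Lemma nonnbr_other x v a : adj x v -> exists2 w, w \in nonnbr x v & w != a.
Proof.
move=> xv; case/andP: (nonnbr_bounds xv) => /card_gt1P[u [w [uv wv uw]]] _.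
by have [E|] := eqVneq u a; [exists w; rewrite // -E eq_sym|exists u].
Qed.

Lemma card_colors T c C : config T c C -> #|C| = 8 - #|T|.
Proof. by case=> _ _ _ <-; rewrite addKn. Qed.

Lemma card_singles_regular T c C x : config T c C -> x \in T ->
  #|singles T c C x| = 5 - #|T|.
Proof.
move=> cf xT; have := card_singles uncolorable claw cf xT; rewrite regular.
case: cf => _ _ _; lia.
Qed.

(** * Cliques of five vertices *)

Lemma config5_missed T c C (S : {set G}) i :
  config T c C -> #|T| = 5 -> (forall a, a \in S -> a \notin T /\ c a = i) -> #|S| = 3 ->
  exists2 a, a \in S & 1 < #|[set v in T | ~~ adj a v]|.
Proof.
move=> cf T5 SP S3; have [/existsP[a /andP[]]|no] := boolP [exists a in S, 1 < #|[set v in T |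
    ~~ adj a v]|].
  by exists a.
have : \sum_(a in S) #|[set v in T | ~~ adj a v]| <= \sum_(a in S) 1.
  apply: leq_sum => a aS; rewrite leqNgt; apply: contraNN no => H; apply/existsP; exists a.
  by rewrite aS.
rewrite sum1_card S3 => le3.
(* Class [i] holds at most two neighbours of each [v], so every vertex of [T] misses one of the
   three in [S]: five misses on three vertices. *)
have : \sum_(v in T) 1 <= \sum_(v in T) #|[set a in S | ~~ adj a v]|.
  apply: leq_sum => v vT; rewrite card_gt0; apply/set0Pn.
  have: ~~ (S \subset cls T c v i).
    by apply/negP => /subset_leq_card; rewrite S3 leqNgt ltnS (cls_le2 claw v i cf).
  case/subsetPn => a aS; rewrite !inE; have [aT -> ] := SP _ aS.
  by rewrite aT eqxx !andbT => va; exists a; rewrite inE aS adjC.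
rewrite sum1_card T5; have -> : \sum_(v in T) #|[set a in S | ~~ adj a v]| = \sum_(a in S)
    #|[set v in T | ~~ adj a v]|.
  have E (A B : {set G}) (r : rel G) : \sum_(v in A) #|[set a in B | r v a]| = \sum_(v in A)
      \sum_(a in B) r v a.
    apply: eq_bigr => v _; rewrite -sum1_card big_mkcond [RHS]big_mkcond.
    by apply: eq_bigr => a _; rewrite inE; case: (a \in B) => //=; case: r.
  by rewrite (E T S (fun v a => ~~ adj a v)) (E S T (fun a v => ~~ adj a v)) exchange_big.
lia.
Qed.

(** No class is single. Two neighbours of [x] that miss [y] lie in different classes, and each forms
    a triple with the two neighbours of [y] in its class. Some [a] in the first triple misses two
    vertices of [T]; it and a nonadjacent [a'] in the second have a common neighbour [z] in [T].
    Among the neighbours of [z], [a] misses its mate, [a'] and two vertices of [T]: one too many. *)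
Lemma config5_false T c C : config T c C -> #|T| = 5 -> False.
Proof.
move=> cf T5.
have no_single x i : x \in T -> i \notin singles T c C x.
  move=> xT; have /eqP := card_singles_regular cf xT; rewrite T5 cards_eq0 => /eqP->.
  by rewrite inE.
have [x xT] : exists x, x \in T by apply/card_gt0P; rewrite T5.
have [y yT yx] := config_other x cf; have xy : x != y by rewrite eq_sym.
have [cl pr _ cd] := cf; have axy := cl _ _ xT yT xy.
have [w1 w1N _] := nonnbr_other x axy; have [w2 w2N w21] := nonnbr_other w1 axy.
have [i iC w1X] := nonnbr_cls cf xT yT w1N; have [j jC w2X] := nonnbr_cls cf xT yT w2N.
have ij : i != j.
  apply: contraNneq w21 => E; rewrite -E in w2X; apply/eqP.
  exact: (nonnbr_cls_inj uncolorable claw cf xT yT xy iC w2N w1N).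
have triple w k : k \in C -> w \in nonnbr x y -> w \in cls T c x k ->
    #|w |: cls T c y k| = 3 /\ forall a, a \in w |: cls T c y k ->
      (exists2 z, z \in T & a \in cls T c z k) /\ (a \notin T /\ c a = k).
  move=> kC wN wX; split.
    have := card_singles_regular cf yT; have := cls_le2 claw y k cf.
    have := cls_gt0 uncolorable cf yT kC; have := no_single y k yT; rewrite !inE kC /=.
    have -> : #|w |: cls T c y k| = #|cls T c y k|.+1.
      by rewrite cardsU1 inE; case/nonnbrP: wN => _ _; rewrite inE => /negbTE->.
    by case: #|cls T c y k| => [|[|[|]]].
  move=> a /setU1P[->|aY]; first by split; [exists x|case/clsP: wX].
  by split; [exists y|case/clsP: aY].
have [S3 SP] := triple _ _ iC w1N w1X; have [S'3 S'P] := triple _ _ jC w2N w2X.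
have [a aS a2] := config5_missed cf T5 (fun a aS => (SP a aS).2) S3.
have [_ [aT ca]] := SP a aS.
(* Otherwise [a] would be the centre of a claw whose leaves are the second triple. *)
have [a' a'S aa'] : exists2 a', a' \in w2 |: cls T c y j & ~~ adj a a'.
  apply/subsetPn/negP => /subsetP sub; have := S'3 => E.
  have /card_gt2P[p [q [r [[pS qS rS] [pq qr rp]]]]] : 2 < #|w2 |: cls T c y j| by rewrite E.
  have := claw (sub _ pS) (sub _ qS) (sub _ rS) pq; rewrite eq_sym rp qr => /(_ isT isT).
  have NA p' q' : p' \in w2 |: cls T c y j -> q' \in w2 |: cls T c y j -> adj p' q' = false.
    move=> /S'P[_ [pT cp]] /S'P[_ [qT cq]].
    by apply/negP => /(pr _ _ pT qT); rewrite cp cq eqxx.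
  rewrite NA // NA // NA //.
(* The mate of [b] among the neighbours of [z] takes one of its three places for nonneighbours,
   leaving two for [T]. *)
have missed_le2 b k : k \in C -> b \notin T -> c b = k -> (exists2 z, z \in T & b \in cls T c
    z k) ->
    #|[set v in T | ~~ adj b v]| <= 2.
  move=> kC bT cb [z zT bZ]; have [b' b'Z b'b] := not_single cf kC (no_single z k zT) bZ.
  have /clsP[zb _ _] := bZ; case/andP: (nonnbr_bounds zb) => _ le3.
  rewrite -ltnS; apply: leq_trans le3; have /clsP[_ b'T _] := b'Z.
  have <- : #|b' |: [set v in T | ~~ adj b v]| = #|[set v in T | ~~ adj b v]|.+1.
    by rewrite cardsU1 inE (negbTE b'T).
  apply/subset_leq_card/subsetP => v /setU1P[->|]; first exact: cls_mate cf bZ b'Z b'b.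
  rewrite inE => /andP[vT bv]; apply/nonnbrP; split=> //; last by apply: contraNneq bT => <-.
  by apply: cl => //; apply: contraNneq bv => <-; rewrite adjC.
have [a'Z [a'T ca']] := S'P a' a'S; have := missed_le2 a' j jC a'T ca' a'Z.
have [aZ _] := SP a aS; have := missed_le2 a i iC aT ca aZ => le2 le2'.
have [|z [zT]] := @exists_outside _ T [set v in T | ~~ adj a v] [set v in T | ~~ adj a' v].
  by rewrite T5; apply: leq_ltn_trans (leq_add le2 le2') _.
rewrite !inE zT /= !negbK => az a'z.
have aX : a \in cls T c z i by apply/clsP; rewrite adjC.
have [b bZ ba] := not_single cf iC (no_single z i zT) aX.
have /card_gt1P[p [q [pM qM pq]]] := a2.
have za : adj z a by rewrite adjC.
have /clsP[_ bT cb] := bZ.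
have MN p' : p' \in [set v in T | ~~ adj a v] -> p' \in T /\ p' \in nonnbr z a.
  rewrite inE => /andP[pT ap]; split=> //; apply/nonnbrP; split=> //.
    by apply: cl => //; apply: contraTneq az => ->.
  by apply: contraNneq aT => <-.
have [pT pN] := MN p pM; have [qT qN] := MN q qM.
have := @nonnbr_le3 z a [:: b; a'; p; q] za; rewrite /= !in_cons !in_nil !orbF !negb_or pq.
have bE r : r \in T -> b != r by move=> rT; apply: contraNneq bT => ->.
have aE r : r \in T -> a' != r by move=> rT; apply: contraNneq a'T => ->.
rewrite (bE p pT) (bE q qT) (aE p pT) (aE q qT) !andbT;
    have -> : b != a' by apply: contraNneq ij => E; rewrite -cb E ca'.
have a'N : a' \in nonnbr z a.
  apply/nonnbrP; split=> //; first by rewrite adjC.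
  by apply: contraNneq ij => E; rewrite -ca -E ca'.
by rewrite pN qN a'N (cls_mate cf aX bZ ba) => /(_ isT isT).
Qed.

(** * Cliques of six vertices *)

Lemma clique_setU1 (K : {set G}) u n :
  clique K -> #|K| = n -> u \notin K -> {in K, forall v, adj u v} ->
  clique (u |: K) /\ #|u |: K| = n.+1.
Proof.
move=> clK cardK uK uA; split; last by rewrite cardsU1 uK cardK.
move=> v w /setU1P[->|vK] /setU1P[->|wK]; last exact: clK.
- by rewrite eqxx.
- by move=> _; apply: uA.
- by move=> _; rewrite adjC; apply: uA.
Qed.

(* Counting nonadjacent pairs between the clique [K :\ x] and the other five
   neighbours of [x]: each vertex of the clique is in at least two of them,
   while a nonadjacent pair [a], [d] would leave room for only nine. *)
Lemma clique6_cross T c C (K : {set G}) x i j a d :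
  config T c C -> x \in T -> clique K -> #|K| = 6 -> x \in K -> i != j ->
  i \in C -> i \notin singles T c C x -> j \in C -> j \notin singles T c C x ->
  (forall v, v \in K -> v \notin cls T c x i :|: cls T c x j) ->
  a \in cls T c x i -> d \in cls T c x j -> adj a d.
Proof.
move=> cf xT clK cardK xK ij iC iS jC jS KX aX dX; apply: contraT => ad.
have [a' a'X a'a] := not_single cf iC iS aX; have [d' d'X d'd] := not_single cf jC jS dX.
pose O := nbr x :\: K.
have inO k v : k \in [:: i; j] -> v \in cls T c x k -> v \in O.
  move=> kij vX; rewrite !inE; have /clsP[-> _ _] := vX; rewrite andbT.
  apply: contraTN kij => /KX; rewrite inE negb_or !in_cons orbF.
  by case/andP=> vi vj; apply/negP => /orP[]/eqP E; move: vi vj; rewrite -E vX.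
have [aO a'O dO d'O] : [/\ a \in O, a' \in O, d \in O & d' \in O].
  by split; [apply: (inO i)|apply: (inO i)|apply: (inO j)|apply: (inO j)];
    rewrite // !inE eqxx ?orbT.
have cE k v : v \in cls T c x k -> c v = k by case/clsP.
have neq v w : v \in cls T c x i -> w \in cls T c x j -> v != w.
  by move=> /cE ci /cE cj; apply: contraNneq ij => E; rewrite -ci -cj E.
have Kx : nbr x :&: K = K :\ x.
  apply/setP => v; rewrite !inE andbC; case vK: (v \in K); rewrite ?andbF //= andbT.
  by have [->|vx] := eqVneq v x; [rewrite adj_irrefl | rewrite clK // eq_sym].
have cardKx : #|K :\ x| = 5 by apply/eqP; rewrite -eqSS -cardK (cardsD1 x K) xK.
have cardO : #|O| = 5.
  by apply/eqP; rewrite -(eqn_add2l 5) -{1}cardKx -Kx cardsID regular.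
have xO o : o \in O -> adj x o by rewrite !inE => /andP[].
have lower : 10 <= \sum_(v in K :\ x) #|nonnbr x v|.
  apply: (@leq_trans (\sum_(v in K :\ x) 2)); first by rewrite sum_nat_const cardKx.
  apply: leq_sum => v; rewrite !inE => /andP[vx vK].
  have xv : adj x v by apply: clK; rewrite // eq_sym.
  by case/andP: (nonnbr_bounds xv).
have swap : \sum_(v in K :\ x) #|nonnbr x v| <= \sum_(o in O) #|nonnbr x o :&: K|.
  have -> : \sum_(v in K :\ x) #|nonnbr x v| = \sum_(v in K :\ x) \sum_(o in O) ~~ adj v o.
    apply: eq_bigr => v; rewrite !inE => /andP[vx vK].
    rewrite -sum1_card big_mkcond [RHS]big_mkcond; apply: eq_bigr => o _.
    rewrite !inE; case xo: (adj x o); rewrite ?andbF //= andbT.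
    have [->|ov] /= := eqVneq o v; first by rewrite vK.
    case oK: (o \in K) => /=; first by rewrite clK // eq_sym.
    by case: (adj v o).
  rewrite exchange_big; apply: leq_sum => o oO /=.
  rewrite -sum1_card [X in _ <= X]big_mkcond [X in X <= _]big_mkcond; apply: leq_sum => v _.
  rewrite !inE; have [->//|vx] := eqVneq v x; case vK: (v \in K) => //=.
  rewrite (adjC o v) (clK x v) // 1?(eq_sym x) //=; case: (adj v o) => //=.
  have -> // : v != o by apply: contraTneq oO => <-; rewrite !inE vK.
have upper : \sum_(o in O) #|nonnbr x o :&: K| + \sum_(o in O) #|nonnbr x o :\: K| <= 15.
  rewrite -big_split /=; apply: (@leq_trans (\sum_(o in O) 3));
      last by rewrite sum_nat_const cardO.
  by apply: leq_sum => o /xO xo; rewrite cardsID; case/andP: (nonnbr_bounds xo).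
have outside o (s : seq G) : o \in O -> uniq s ->
    all (fun v => [&& v \in O, v != o & ~~ adj o v]) s -> size s <= #|nonnbr x o :\: K|.
  move=> oO us /allP sP; apply: size_uniq_leq_card => // v /sP.
  by rewrite !inE => /and3P[/andP[-> ->] -> ->].
have na' : ~~ adj a a' := cls_nonadj cf aX a'X.
have nd' : ~~ adj d d' := cls_nonadj cf dX d'X.
(* Nonadjacencies within [O]: [a] and [d] miss their mates and each other, and each mate misses its
   partner, in all 2 + 2 + 1 + 1. *)
have ha : 2 <= #|nonnbr x a :\: K|.
  apply: (outside a [:: a'; d]) => //=; first by rewrite mem_seq1 (neq _ _ a'X dX).
  by rewrite a'O dO a'a na' ad eq_sym (neq _ _ aX dX).
have hd : 2 <= #|nonnbr x d :\: K|.
  apply: (outside d [:: d'; a]) => //=.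
    by rewrite mem_seq1 eq_sym (neq _ _ aX d'X).
  by rewrite d'O aO d'd nd' (adjC d) ad (neq _ _ aX dX).
have ha' : 1 <= #|nonnbr x a' :\: K|.
  by apply: (outside a' [:: a]); rewrite //= aO eq_sym a'a adjC na'.
have hd' : 1 <= #|nonnbr x d' :\: K|.
  by apply: (outside d' [:: d]); rewrite //= dO eq_sym d'd adjC nd'.
have : 6 <= \sum_(o in O) #|nonnbr x o :\: K|.
  rewrite (bigD1 a) // (bigD1 a') ?a'O //= (bigD1 d) /=; last first.
    by rewrite dO !(eq_sym d) (neq _ _ aX dX) (neq _ _ a'X dX).
  rewrite (bigD1 d') /=; last by rewrite d'O !(eq_sym d') (neq _ _ aX d'X) (neq _ _ a'X d'X)
      /= eq_sym.
  by rewrite !addnA; apply: leq_trans (leq_addr _ _);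
      apply: (leq_add (leq_add (leq_add ha ha') hd) hd').
move=> six; have := leq_trans (leq_add (leq_trans lower swap) six) upper.
by [].
Qed.

(** By [clique6_cross] at [x] and at [y], a common neighbour [e] in class [j] is adjacent to all
    neighbours of [x] or [y] in class [i]. These are at least three, [w] and two neighbours of [y]:
    a claw centred at [e]. *)
Lemma clique6_false T c C (K : {set G}) x y i j w :
  config T c C -> x \in T -> y \in T -> x != y ->
  clique K -> #|K| = 6 -> x \in K -> y \in K -> i != j -> i \in C -> j \in C ->
  i \notin singles T c C x -> j \notin singles T c C x ->
  i \notin singles T c C y -> j \notin singles T c C y ->
  (forall v, v \in K -> v \notin T -> (c v != i) && (c v != j)) ->
  w \in cls T c x i -> ~~ adj y w -> False.
Proof.
move=> cf xT yT xy clK cardK xK yK ij iC jC iX jX iY jY KP wX yw.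
have KX z v : v \in K -> v \notin cls T c z i :|: cls T c z j.
  move=> vK; rewrite inE; apply/negP => /orP[]/clsP[_ vT E];
    by have /andP[] := KP v vK vT; rewrite E eqxx.
have [e [eX eY]] := kempe1 uncolorable cf xT yT xy jC.
have cX z u : z \in T -> z \in K -> i \notin singles T c C z -> j \notin singles T c C z ->
    u \in cls T c z i -> e \in cls T c z j -> adj e u.
  move=> zT zK iZ jZ uZ eZ; rewrite adjC.
  exact: (clique6_cross cf zT clK cardK zK ij iC iZ jC jZ (KX z) uZ eZ).
have [p [pX pY]] := kempe1 uncolorable cf xT yT xy iC.
have [q qY qp] := not_single cf iC iY pY.
have wn u : u \in cls T c y i -> w != u by case/clsP => yu _ _; apply: contraNneq yw => ->.
have := claw (cX x w xT xK iX jX wX eX) (cX y p yT yK iY jY pY eY) (cX y q yT yK iY jY qY eY).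
rewrite !wn // eq_sym qp (negbTE (cls_nonadj cf wX pY)) (negbTE (cls_nonadj cf wX qY)).
by rewrite (negbTE (cls_nonadj cf pY qY)) => /(_ isT isT isT).
Qed.

(** At least two neighbours of [x] miss [y] and no class holds two of them, so one lies outside
    class [l]. Its class is not single for [x], as a single neighbour would be adjacent to [y]. *)
Lemma other_nonnbr T c C x y l :
  config T c C -> x \in T -> y \in T -> x != y -> l \in C ->
  exists i w, [/\ i \in C, i != l, i \notin singles T c C x, w \in cls T c x i & ~~ adj y w].
Proof.
move=> cf xT yT xy lC; have [cl _ _ _] := cf; have axy := cl _ _ xT yT xy.
have [v vN _] := nonnbr_other x axy; have [w wN wv] := nonnbr_other v axy.
have pick z : z \in nonnbr x y -> z \notin cls T c x l ->
    exists i w, [/\ i \in C, i != l, i \notin singles T c C x, w \in cls T c x i & ~~ adj y w].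
  move=> zN zl; have [i iC zX] := nonnbr_cls cf xT yT zN; have /nonnbrP[_ _ yz] := zN.
  exists i, z; split=> //; last exact: (single_of_not_adj uncolorable cf xT yT iC zX).
  by apply: contraNneq zl => <-.
have [vl|/(pick _ vN)//] := boolP (v \in cls T c x l).
apply: (pick w wN); apply: contraNN wv => wl; apply/eqP.
exact: (nonnbr_cls_inj uncolorable claw cf xT yT xy lC wN vN).
Qed.

(** * Cliques of three vertices *)

Lemma single_adj T c C x y i u :
  config T c C -> x \in T -> y \in T -> i \in singles T c C x ->
  u \in cls T c x i -> adj y u.
Proof. by move=> cf xT yT iX uX; case/clsP: (single_common uncolorable cf xT yT iX uX). Qed.

Lemma nonnbr_single T c C x y i u v :
  config T c C -> x \in T -> y \in T -> i \in singles T c C x ->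
  u \in cls T c x i -> v \in nonnbr y u -> exists2 k, k \in C & v \in cls T c y k.
Proof.
move=> cf xT yT iX uX /nonnbrP[yv vu uv].
have vT : v \notin T.
  by apply: contraNN uv => vT; rewrite adjC (single_adj cf xT vT iX uX).
by have [cv vY] := mem_nbr cf yT yv vT; exists (c v).
Qed.

Lemma nonnbr_of_single T c C x y i u b :
  config T c C -> x \in T -> y \in T -> x != y -> i \in singles T c C y ->
  u \in cls T c y i -> b \in cls T c x i -> b != u -> y \in nonnbr x b.
Proof.
move=> cf xT yT xy iY uY bX bu; have [cl _ _ _] := cf.
have /clsP[_ bT cb] := bX; apply/nonnbrP; split; first exact: cl.
  by apply: contraNneq bT => <-.
by rewrite adjC; apply: contraNN bu => yb; rewrite (single_eq iY uY (mem_cls_of_adj yT bX yb)).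
Qed.

(** Each of the four single neighbours turns out to miss a neighbour of [x] in the fifth class [i5].
    This leaves the vertices of [i5] no room to miss a vertex of [T]. Then all neighbours of [y]
    that miss [u3] lie in [i5]; two of them form with [u3] the leaves of a claw. *)
Lemma config3_disjoint T c C x y z i1 i2 i3 i4 :
  config T c C -> #|T| = 3 -> x \in T -> y \in T -> z \in T ->
  x != y -> x != z -> y != z ->
  i1 \in singles T c C x -> i2 \in singles T c C x -> i1 != i2 ->
  i3 \in singles T c C y -> i4 \in singles T c C y -> i3 != i4 ->
  i3 \in singles T c C z -> i4 \in singles T c C z ->
  i3 \notin singles T c C x -> i4 \notin singles T c C x -> False.
Proof.
move=> cf T3 xT yT zT xy xz yz P1 P2 i12 P3 P4 i34 Q3 Q4 nP3 nP4.
have [cl _ _ _] := cf.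
have cardP t : t \in T -> #|singles T c C t| <= 2.
  by move=> tT; rewrite (card_singles_regular cf tT) T3.
have Px := set2_eq P1 P2 i12 (cardP x xT).
have Py := set2_eq P3 P4 i34 (cardP y yT).
have Pz := set2_eq Q3 Q4 i34 (cardP z zT).
have i13 : i1 != i3 by apply: contraNneq nP3 => <-.
have i14 : i1 != i4 by apply: contraNneq nP4 => <-.
have i23 : i2 != i3 by apply: contraNneq nP3 => <-.
have i24 : i2 != i4 by apply: contraNneq nP4 => <-.
have cardC : #|C| = 5 by rewrite (card_colors cf) T3.
have [i5 i5C i5n] : exists2 i5, i5 \in C & i5 \notin [:: i1; i2; i3; i4].
  have : ~~ (C \subset [:: i1; i2; i3; i4]).
    by apply/negP => /subset_leq_card; rewrite cardC leqNgt ltnS card_size.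
  by case/subsetPn => i5; exists i5.
have u5 : uniq [:: i5; i1; i2; i3; i4].
  by rewrite cons_uniq i5n /= !inE !negb_or i12 i13 i14 i23 i24 i34.
have C5 k : k \in C -> k \in [:: i5; i1; i2; i3; i4].
  move=> kC; apply: contraT => kn; have := @size_uniq_leq_card _ C (k :: [:: i5; i1; i2; i3;
      i4]).
  rewrite cardC cons_uniq kn u5 => /(_ isT) H; suff /H : {subset k :: [:: i5; i1; i2; i3;
      i4] <= C} by [].
  move=> l; rewrite !in_cons in_nil orbF => /or4P[/eqP->|/eqP->|/eqP->|] //.
    exact: singlesC P1.
  by case/or3P=> /eqP->; [apply: singlesC P2|apply: singlesC P3|apply: singlesC P4].
have /card_gt0P[u1 X1] := cls_gt0 uncolorable cf xT (singlesC P1).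
have /card_gt0P[u2 X2] := cls_gt0 uncolorable cf xT (singlesC P2).
have /card_gt0P[u3 Y3] := cls_gt0 uncolorable cf yT (singlesC P3).
have /card_gt0P[u4 Y4] := cls_gt0 uncolorable cf yT (singlesC P4).
have X3 := single_common uncolorable cf yT xT P3 Y3.
have X4 := single_common uncolorable cf yT xT P4 Y4.
have Z3 := single_common uncolorable cf yT zT P3 Y3.
have Z4 := single_common uncolorable cf yT zT P4 Y4.
have a13 := single_link uncolorable cf xT yT xy i13 P1 P3 X1 Y3.
have a14 := single_link uncolorable cf xT yT xy i14 P1 P4 X1 Y4.
have a23 := single_link uncolorable cf xT yT xy i23 P2 P3 X2 Y3.
have a24 := single_link uncolorable cf xT yT xy i24 P2 P4 X2 Y4.
have a34 := single_link uncolorable cf yT zT yz i34 P3 Q4 Y3 Z4.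
have cE t k v : v \in cls T c t k -> c v = k by case/clsP.
have neq t t' k k' v v' : v \in cls T c t k -> v' \in cls T c t' k' -> k != k' -> v != v'.
  by move=> /cE ck /cE ck'; apply: contra_neq => E; rewrite -ck -ck' E.
have notT t k v w : v \in cls T c t k -> w \in T -> w != v.
  by move=> /clsP[_ vT _] wT; apply: contraNneq vT => <-.
(* [b] misses [y] and [z], whose only neighbour in class [k] is [u], and also [u] itself. These fill
   its three places, so [b] is adjacent to all other neighbours of [x]. *)
have second k u : k \in C -> k \notin singles T c C x -> k \in singles T c C y ->
    k \in singles T c C z -> u \in cls T c x k -> u \in cls T c y k -> u \in cls T c z k ->
    exists b, [/\ b \in cls T c x k, b != u, cls T c x k = [set u; b] &
      forall v, v \in nonnbr x b -> v \in [:: y; z; u]].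
  move=> kC kx ky kz uX uY uZ; have [b bX bu] := not_single cf kC kx uX.
  exists b; split=> //.
    by apply: set2_eq => //; [rewrite eq_sym | apply: cls_le2 cf].
  have /clsP[xb _ _] := bX; move=> v; apply: nonnbr_full => //.
  - by rewrite /= !inE negb_or yz !(notT _ _ _ _ uX).
  - exact: nonnbr_of_single cf xT yT xy ky uY bX bu.
  - exact: nonnbr_of_single cf xT zT xz kz uZ bX bu.
  - by apply: cls_mate cf bX uX _; rewrite eq_sym.
have [b3 [bX3 bu3 EX3 full3]] := second _ _ (singlesC P3) nP3 P3 Q3 X3 Y3 Z3.
have [b4 [bX4 bu4 EX4 full4]] := second _ _ (singlesC P4) nP4 P4 Q4 X4 Y4 Z4.
have b_far v k b u : adj x v -> v \notin [:: y; z; u] -> b \in cls T c x k ->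
    (forall w, w \in nonnbr x b -> w \in [:: y; z; u]) -> b \notin nonnbr x v.
  by move=> xv vn bX full; apply: contraNN vn => bv; apply/full/nonnbr_sym.
have un t k v w : v \in cls T c t k -> w != v -> v \notin [:: y; z; w].
  by move=> vX wv; rewrite !inE !negb_or !(eq_sym v) wv !(notT _ _ _ _ vX).
have xu k u : u \in cls T c x k -> adj x u by case/clsP.
(* Take a nonneighbour of [u] other than [e]. In the four classes besides [i5] there are only [u],
   [e], the neighbours [u3] and [u4] of [u], and [b3] and [b4], whose places are filled. *)
have hit1 i i' u e : i \in singles T c C x -> i' \in singles T c C x ->
    u \in cls T c x i -> e \in cls T c x i' -> adj u u3 -> adj u u4 ->
    u3 != u -> u4 != u -> (forall k, k \in C -> k \in [:: i5; i; i'; i3; i4]) ->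
    exists2 v, v \in cls T c x i5 & v \in nonnbr x u.
  move=> Pi Pi' uX eX au3 au4 u3u u4u iC; have [v vN ve] := nonnbr_other e (xu _ _ uX).
  have [k kC vX] := nonnbr_single cf xT xT Pi uX vN; exists v => //.
  have /nonnbrP[_ vu uv] := vN.
  move: (iC k kC); rewrite !in_cons in_nil orbF => /or4P[/eqP<-//|/eqP E|/eqP E|/orP[]/eqP E];
      subst k.
  - by rewrite (single_eq Pi vX uX) eqxx in vu.
  - by rewrite (single_eq Pi' vX eX) eqxx in ve.
  - move: vX; rewrite EX3 => /set2P[E|E]; subst v; first by rewrite au3 in uv.
    by have := b_far u _ _ _ (xu _ _ uX) (un _ _ _ _ uX u3u) bX3 full3; rewrite vN.
  - move: vX; rewrite EX4 => /set2P[E|E]; subst v; first by rewrite au4 in uv.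
    by have := b_far u _ _ _ (xu _ _ uX) (un _ _ _ _ uX u4u) bX4 full4; rewrite vN.
have hit2 i i' u b u' b' : u \in cls T c x i -> i \in singles T c C y -> u \in cls T c y i ->
    cls T c x i = [set u; b] -> cls T c x i' = [set u'; b'] ->
    adj u u1 -> adj u u2 -> adj u u' -> u' != u -> b' \in cls T c x i' ->
    (forall w, w \in nonnbr x b' -> w \in [:: y; z; u']) ->
    (forall k, k \in C -> k \in [:: i5; i1; i2; i; i']) ->
    exists2 v, v \in cls T c x i5 & v \in nonnbr x u.
  move=> uX Pi uY EX EX' au1 au2 au' u'u b'X full iC.
  have [v vN ve] := nonnbr_other b (xu _ _ uX).
  have [k kC vX] := nonnbr_single cf yT xT Pi uY vN; exists v => //.
  have /nonnbrP[_ vu uv] := vN.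
  move: (iC k kC); rewrite !in_cons in_nil orbF => /or4P[/eqP<-//|/eqP E|/eqP E|/orP[]/eqP E];
      subst k.
  - by rewrite (single_eq P1 vX X1) au1 in uv.
  - by rewrite (single_eq P2 vX X2) au2 in uv.
  - by move: vX; rewrite EX => /set2P[] E; subst v; rewrite eqxx in vu ve.
  - move: vX; rewrite EX' => /set2P[E|E]; subst v; first by rewrite au' in uv.
    by have := b_far u _ _ _ (xu _ _ uX) (un _ _ _ _ uX u'u) b'X full; rewrite vN.
have n12 := neq _ _ _ _ _ _ X1 X2 i12; have n13 := neq _ _ _ _ _ _ X1 X3 i13.
have n14 := neq _ _ _ _ _ _ X1 X4 i14; have n23 := neq _ _ _ _ _ _ X2 X3 i23.
have n24 := neq _ _ _ _ _ _ X2 X4 i24; have n34 := neq _ _ _ _ _ _ X3 X4 i34.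
have h1 : exists2 v, v \in cls T c x i5 & v \in nonnbr x u1.
  by apply: (hit1 i1 i2 u1 u2); rewrite // 1?eq_sym.
have h2 : exists2 v, v \in cls T c x i5 & v \in nonnbr x u2.
  apply: (hit1 i2 i1 u2 u1); rewrite // 1?eq_sym // => k /C5.
  by rewrite !inE orbCA => /or4P[->|->|->|/orP[->|->]]; rewrite ?orbT.
have h3 : exists2 v, v \in cls T c x i5 & v \in nonnbr x u3.
  by apply: (hit2 i3 i4 u3 b3 u4 b4); rewrite // 1?adjC // 1?eq_sym.
have h4 : exists2 v, v \in cls T c x i5 & v \in nonnbr x u4.
  apply: (hit2 i4 i3 u4 b4 u3 b3); rewrite // 1?adjC // => k /C5.
  by rewrite !inE => /or4P[->|->|->|/orP[->|->]]; rewrite ?orbT.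
have nP5 : i5 \notin singles T c C x.
  by rewrite Px !inE negb_or; move: i5n; rewrite !inE !negb_or => /and4P[-> ->].
(* The three slots of the two vertices of class 5 are used up by their mate and
   by [u1], ..., [u4], so none is left for a vertex of the clique [T]. *)
have X5adj a t : t \in T -> a \in cls T c x i5 -> adj t a.
  move=> tT aX; have [->|tx] := eqVneq t x; first exact: xu aX.
  apply: contraT => ta; have [a' a'X a'a] := not_single cf i5C nP5 aX.
  have inU v : v \in cls T c x i5 -> forall u, v \in nonnbr x u -> adj x u -> u \in nonnbr x a
      :|: nonnbr x a'.
    move=> vX u vu xu'; rewrite inE; have aa' : a != a' by rewrite eq_sym.
    by case: (cls_two claw cf aX a'X aa' vX) => E; subst v; rewrite (nonnbr_sym xu' vu) ?orbT.
  have /andP[_ la] := nonnbr_bounds (xu _ _ aX); have /andP[_ la'] := nonnbr_bounds (xu _ _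
      a'X).
  have le6 := leq_trans (leq_card_setU _ _) (leq_add la la').
  suff : 7 <= #|nonnbr x a :|: nonnbr x a'| by rewrite ltnNge le6.
  apply: (@size_uniq_leq_card _ _ [:: t; a; a'; u1; u2; u3; u4]).
    rewrite cons_uniq; apply/andP; split.
      by rewrite !inE !negb_or (notT _ _ _ _ aX) // (notT _ _ _ _ a'X) // (notT _ _ _ _ X1) //
          (notT _ _ _ _ X2) // (notT _ _ _ _ X3) // (notT _ _ _ _ X4).
    rewrite cons_uniq !in_cons in_nil orbF negb_or eq_sym a'a /=.
    move: u5; rewrite cons_uniq !in_cons in_nil orbF !negb_or => /andP[/and4P[i51 i52 i53 i54]
        _].
    rewrite (neq _ _ _ _ _ _ aX X1 i51) (neq _ _ _ _ _ _ aX X2 i52).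
    rewrite (neq _ _ _ _ _ _ aX X3 i53) (neq _ _ _ _ _ _ aX X4 i54) /=.
    rewrite (neq _ _ _ _ _ _ a'X X1 i51) (neq _ _ _ _ _ _ a'X X2 i52).
    rewrite (neq _ _ _ _ _ _ a'X X3 i53) (neq _ _ _ _ _ _ a'X X4 i54) /=.
    by rewrite n12 n13 n14 n23 n24 n34.
  move=> v; rewrite (in_cons t) => /orP[/eqP->|].
    rewrite inE; apply/orP; left; apply/nonnbrP; split; [by apply: cl;
        rewrite // eq_sym| |by rewrite adjC].
    exact: notT _ _ _ _ aX tT.
  rewrite (in_cons a) => /orP[/eqP->|].
    by rewrite inE (cls_mate cf a'X aX) ?orbT // eq_sym.
  rewrite (in_cons a') => /orP[/eqP->|]; first by rewrite inE (cls_mate cf aX a'X).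
  rewrite !in_cons in_nil orbF => /or4P[]/eqP->.
  - by case: h1 => w wX wN; apply: (inU w) (xu _ _ X1).
  - by case: h2 => w wX wN; apply: (inU w) (xu _ _ X2).
  - by case: h3 => w wX wN; apply: (inU w) (xu _ _ X3).
  - by case: h4 => w wX wN; apply: (inU w) (xu _ _ X4).
have Y5 v : v \in cls T c y i5 -> v \in cls T c x i5.
  have /card_gt0P[a aX] := cls_gt0 uncolorable cf xT i5C.
  have [a' a'X a'a] := not_single cf i5C nP5 aX.
  have aY := mem_cls_of_adj yT aX (X5adj _ _ yT aX).
  have a'Y := mem_cls_of_adj yT a'X (X5adj _ _ yT a'X).
  by case/(cls_two claw cf a'Y aY a'a) => ->.
(* [v] must be [w], which then misses [x], [z], [u] and [u3] among the neighbours of [y]: one too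
   many. *)
have Y12 k u : k \in singles T c C x -> u \in cls T c x k ->
    (exists2 w, w \in cls T c y k & ~~ adj z w) -> forall v, v \in cls T c y k ->
    adj u u3 -> v \in nonnbr y u3 -> False.
  move=> Pk uX [w wY zw] v vY au vN.
  have uY := single_common uncolorable cf xT yT Pk uX.
  have uZ := single_common uncolorable cf xT zT Pk uX.
  have uw : w != u by apply: contraNneq zw => ->; case/clsP: uZ.
  have /nonnbrP[_ vu3 u3v] := vN.
  have [E|E] := cls_two claw cf wY uY uw vY; subst v; last by rewrite adjC au in u3v.
  have /clsP[yw _ _] := wY; have yx : y != x by rewrite eq_sym.
  have : u3 \in [:: x; z; u].
    apply: (@nonnbr_full y w); rewrite //.
    - by rewrite /= !inE negb_or xz !(notT _ _ _ _ uX).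
    - exact: nonnbr_of_single cf yT xT yx Pk uX wY uw.
    - apply/nonnbrP; split; [exact: cl|exact: notT wY zT|by rewrite adjC].
    - by apply: cls_mate cf wY uY _; rewrite eq_sym.
    - by apply: nonnbr_sym vN; case/clsP: Y3.
  rewrite !in_cons in_nil orbF => /or3P[]/eqP E.
  - by have := notT _ _ _ _ Y3 xT; rewrite E eqxx.
  - by have := notT _ _ _ _ Y3 zT; rewrite E eqxx.
  - by rewrite E adj_irrefl in au.
(* [l] is the other one of [i1] and [i2]. A neighbour of [y] missing [z] outside class [l] can only
   be in class [k]: [i3] and [i4] are single for [y], and [z] is adjacent to the neighbours of [y]
   in [i5]. *)
have wcase k : k \in [:: i1; i2] -> exists2 w, w \in cls T c y k & ~~ adj z w.
  move=> k12; pose l := if k == i1 then i2 else i1.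
  have lC : l \in C by rewrite /l; case: eqP => _; [apply: singlesC P2|apply: singlesC P1].
  have [j [w [jC jl jy wY zw]]] := other_nonnbr cf yT zT yz lC.
  suff -> : k = j by exists w.
  have /= := C5 j jC; rewrite !in_cons in_nil orbF => /or4P[/eqP E|/eqP E|/eqP E|/orP[]/eqP E].
  - by move: wY; rewrite E => /Y5/(X5adj _ _ zT); rewrite (negbTE zw).
  - by move: jl k12; rewrite /l E !inE; case: (eqVneq k i1) => //=; rewrite ?eqxx.
  - by move: jl k12; rewrite /l E !inE; case: (eqVneq k i1) => //=;
      rewrite ?eqxx //= => _ _ /eqP.
  - by rewrite E P3 in jy.
  - by rewrite E P4 in jy.
have yu3 : adj y u3 by case/clsP: Y3.
have N5 v : v \in nonnbr y u3 -> v \in cls T c y i5.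
  move=> vN; have [k kC vY] := nonnbr_single cf yT yT P3 Y3 vN; have /nonnbrP[_ vu u3v] := vN.
  have := C5 k kC; rewrite !in_cons in_nil orbF => /or4P[/eqP<-//|/eqP E|/eqP E|/orP[]/eqP E];
      subst k.
  - by case: (Y12 i1 u1 P1 X1 (wcase _ _) v vY a13 vN); rewrite !inE eqxx.
  - by case: (Y12 i2 u2 P2 X2 (wcase _ _) v vY a23 vN); rewrite !inE eqxx orbT.
  - by rewrite (single_eq P3 vY Y3) eqxx in vu.
  - by rewrite (single_eq P4 vY Y4) a34 in u3v.
have [v1 v1N _] := nonnbr_other y yu3; have [v2 v2N v21] := nonnbr_other v1 yu3.
apply: (nonnbr_triangle claw yu3 v1N v2N).
exact: cls_mate cf (N5 _ v1N) (N5 _ v2N) v21.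
Qed.

Lemma third T x y : #|T| = 3 -> x \in T -> y \in T -> x != y ->
  exists z, [/\ z \in T, x != z, y != z & forall t, t \in T -> [|| t == x, t == y | t == z]].
Proof.
move=> T3 xT yT xy.
have [z [zT zx zy]] : exists z, [/\ z \in T, z \notin [set x] & z \notin [set y]].
  by apply: exists_outside; rewrite !cards1 T3.
rewrite !inE in zx zy; exists z; split; rewrite // 1?eq_sym //.
have <- : [set x; y; z] = T.
  apply/eqP; rewrite eqEcard T3 !subUset !sub1set xT yT zT.
  by rewrite setUC cardsU1 cards2 !inE negb_or xy zx zy.
by move=> t; rewrite !inE orbA.
Qed.

Lemma single2 T c C x i : config T c C -> #|T| = 3 -> x \in T -> i \in singles T c C x ->
  exists k, [/\ k \in singles T c C x, i != k & singles T c C x = [set i; k]].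
Proof.
move=> cf T3 xT iX; have S2 : #|singles T c C x| = 2 by rewrite (card_singles_regular cf xT) T3.
have /card_gt0P[k /setD1P[ki kX]] : 0 < #|singles T c C x :\ i|.
  by move: S2; rewrite (cardsD1 i) iX add1n => -[->].
exists k; split=> //; first by rewrite eq_sym.
by apply: set2_eq => //; [rewrite eq_sym | rewrite S2].
Qed.

(** If the second single classes [k] of [x] and [l] of [y] coincide, those of [z] avoid both [j] and
    [k], and [config3_disjoint] applies with [z] in the place of [x]. Otherwise [uj], [uk] and [ul]
    extend [T] to a six-clique, refuted by [clique6_false] or completed to a K_7 by a single
    neighbour of [z]. *)
Lemma config3_pair_shared T c C x y z j :
  config T c C -> #|T| = 3 -> x \in T -> y \in T -> z \in T ->
  x != y -> x != z -> y != z ->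
  j \in singles T c C x -> j \in singles T c C y ->
  (forall i, i \in singles T c C x -> i \in singles T c C y -> i \notin singles T c C z) ->
      False.
Proof.
move=> cf T3 xT yT zT xy xz yz jx jy none; have [cl _ _ _] := cf.
have jz := none _ jx jy.
have [k [kx jk Px]] := single2 cf T3 xT jx; have [l [ly jl Py]] := single2 cf T3 yT jy.
have [k_l|k_l] := eqVneq k l.
  subst l; have kz := none _ kx ly.
  have /card_gt0P[p pz] : 0 < #|singles T c C z|.
    by rewrite (card_singles_regular cf zT) T3.
  have [q [qz pq Pz]] := single2 cf T3 zT pz.
  by apply: (@config3_disjoint T c C z x y p q j k); rewrite // eq_sym.
have /card_gt0P[uj Xj] := cls_gt0 uncolorable cf xT (singlesC jx).
have /card_gt0P[uk Xk] := cls_gt0 uncolorable cf xT (singlesC kx).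
have /card_gt0P[ul Yl] := cls_gt0 uncolorable cf yT (singlesC ly).
have Yj := single_common uncolorable cf xT yT jx Xj.
have yx : y != x by rewrite eq_sym.
have kj : k != j by rewrite eq_sym.
have a_kj := single_link uncolorable cf xT yT xy kj kx jy Xk Yj.
have a_lj : adj ul uj.
  by apply: (single_link uncolorable cf yT xT yx _ ly jx Yl Xj); rewrite eq_sym.
have a_lk : adj ul uk.
  by apply: (single_link uncolorable cf yT xT yx _ ly kx Yl Xk); rewrite eq_sym.
have /clsP[_ ujT cj] := Xj; have /clsP[_ ukT ck] := Xk; have /clsP[_ ulT cl'] := Yl.
have [clj cardj] : clique (uj |: T) /\ #|uj |: T| = 4.
  apply: clique_setU1 => // v vT; rewrite adjC.
  exact: single_adj cf xT vT jx Xj.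
have [clk cardk] : clique (uk |: (uj |: T)) /\ #|uk |: (uj |: T)| = 5.
  apply: clique_setU1 => //.
    by rewrite !inE negb_or ukT andbT; apply: contraNneq kj => E; rewrite -ck E cj.
  move=> v /setU1P[->//|vT]; rewrite adjC; exact: single_adj cf xT vT kx Xk.
have [cll cardl] : clique (ul |: (uk |: (uj |: T))) /\ #|ul |: (uk |: (uj |: T))| = 6.
  apply: clique_setU1 => //.
    rewrite !inE !negb_or ulT andbT; apply/andP; split.
      by apply: contraNneq k_l => E; rewrite -ck -E cl'.
    by apply: contraNneq jl => E; rewrite -cj -E cl'.
  move=> v /setU1P[->//|/setU1P[->//|vT]]; rewrite adjC; exact: single_adj cf yT vT ly Yl.
have [sub|] := boolP (singles T c C z \subset [set k; l]).
  have [i [w [iC il ix wX yw]]] := other_nonnbr cf xT yT xy (singlesC ly).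
  have [i' [i'C i'jk i'li]] : exists i', [/\ i' \in C, i' \notin [set j;
      k] & i' \notin [set l; i]].
    by apply: exists_outside; rewrite !cards2 jk eq_sym il (card_colors cf) T3.
  have lx : l \notin singles T c C x by rewrite Px !inE negb_or eq_sym jl eq_sym k_l.
  have ky : k \notin singles T c C y by rewrite Py !inE negb_or eq_sym jk k_l.
  move: i'jk i'li; rewrite !inE !negb_or => /andP[i'j i'k] /andP[i'l i'i].
  move: (ix); rewrite Px !inE negb_or => /andP[ij ik].
  apply: (@clique6_false T c C (ul |: (uk |: (uj |: T))) x y i i' w);
    rewrite // ?Px ?Py ?inE ?negb_or ?xT ?yT ?ij ?ik ?i'j ?i'k ?il ?i'l ?orbT //.
    by rewrite eq_sym.
  move=> v; rewrite !inE => /or4P[/eqP->|/eqP->|/eqP->|->//] _.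
  - by rewrite cl' !(eq_sym l) il i'l.
  - by rewrite ck !(eq_sym k) ik i'k.
  - by rewrite cj !(eq_sym j) ij i'j.
case/subsetPn => r rz; rewrite !inE negb_or => /andP[rk rl].
have rj : r != j by apply: contraTneq rz => ->.
have /card_gt0P[ur Zr] := cls_gt0 uncolorable cf zT (singlesC rz).
have [zx zy] : z != x /\ z != y by rewrite !(eq_sym z).
have /clsP[_ urT cr] := Zr.
have [clr cardr] : clique (ur |: (ul |: (uk |: (uj |: T)))) /\
    #|ur |: (ul |: (uk |: (uj |: T)))| = 7.
  apply: clique_setU1 => //.
    rewrite !inE !negb_or urT andbT; apply/and3P; split.
    - by apply: contraNneq rl => E; rewrite -cr E cl'.
    - by apply: contraNneq rk => E; rewrite -cr E ck.
    - by apply: contraNneq rj => E; rewrite -cr E cj.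
  move=> v /setU1P[->|/setU1P[->|/setU1P[->|vT]]].
  - exact: single_link cf zT yT zy rl rz ly Zr Yl.
  - exact: single_link cf zT xT zx rk rz kx Zr Xk.
  - exact: single_link cf zT xT zx rj rz jx Zr Xj.
  - by rewrite adjC; apply: single_adj cf zT vT rz Zr.
by have := no_K7 clr; rewrite cardr.
Qed.

(** Otherwise [config3_pair_shared] makes the three pairs of single classes disjoint, but [C] has
    only five classes. *)
Lemma config3_common T c C : config T c C -> #|T| = 3 ->
  exists j, {in T, forall t, j \in singles T c C t}.
Proof.
move=> cf T3; have /card_gt0P[x xT] : 0 < #|T| by rewrite T3.
have [y yT yx] := config_other x cf; have xy : x != y by rewrite eq_sym.
have [z [zT xz yz TE]] := third T3 xT yT xy.
pose S := singles T c C.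
have [/existsP[j /and3P[jx jy jz]]|no] := boolP [exists j, [&& j \in S x, j \in S y & j \in S
    z]].
  by exists j => t /TE/or3P[]/eqP->.
have none i : ~~ [&& i \in S x, i \in S y & i \in S z].
  by apply: contraNN no => H; apply/existsP; exists i.
exfalso; have S2 t : t \in T -> #|S t| = 2.
  by move=> tT; rewrite /S (card_singles_regular cf tT) T3.
have C5 : #|C| = 5 by rewrite (card_colors cf) T3.
have sub t : t \in T -> S t \subset C by move=> tT; apply/subsetP => i /singlesC.
have disj t t' r : t \in T -> t' \in T -> r \in T -> t != t' -> t != r -> t' != r ->
    (forall i, i \in S t -> i \in S t' -> i \notin S r) -> [disjoint S t & S t'].
  move=> tT t'T rT tt' tr t'r nn; rewrite -setI_eq0; apply/eqP/setP => i; rewrite !inE.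
  apply/negbTE/negP => /andP[it it'].
  by apply: (config3_pair_shared cf T3 tT t'T rT tt' tr t'r (j := i)); rewrite // inE.
have [zx zy] : z != x /\ z != y by rewrite !(eq_sym z).
have d1 := disj x y z xT yT zT xy xz yz.
have d2 := disj x z y xT zT yT xz xy zy.
have d3 := disj y z x yT zT xT yz yx zx.
have : #|S x :|: S y :|: S z| <= 5.
  by rewrite -[X in _ <= X]C5; apply: subset_leq_card; rewrite !subUset !sub.
have {}d1 : [disjoint S x & S y].
  by apply: d1 => i ix iy; have := none i; rewrite ix iy /=.
have {}d2 : [disjoint S x & S z].
  by apply: d2 => i ix iy; have := none i; rewrite ix iy /= ?andbT.
have {}d3 : [disjoint S y & S z].
  by apply: d3 => i ix iy; have := none i; rewrite ix iy /= ?andbT.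
move: d1 d2 d3; rewrite -!setI_eq0 => /eqP d1 /eqP d2 /eqP d3.
rewrite cardsU setIUl d2 d3 setU0 cards0 subn0 cardsU d1 cards0 subn0.
by rewrite !S2.
Qed.

(** * Exchanging a vertex of the clique *)

Lemma cls_drop T c C x t i i0 :
  config T c C -> x \in T -> t \in T -> t != x -> i0 \notin C -> i \in C ->
  cls (T :\ x) (recolor c [set x] i0) t i = cls T c t i.
Proof.
move=> cf xT tT tx i0C iC; apply/setP => v; rewrite !inE /recolor in_set1 negb_and negbK.
have [->|vx] //= := eqVneq v x; rewrite xT /=.
have -> : i0 == i = false by apply: contraNF i0C => /eqP->.
by rewrite !andbF.
Qed.

Lemma cls_drop_new T c C x t i0 :
  config T c C -> x \in T -> t \in T -> t != x -> i0 \notin C ->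
  cls (T :\ x) (recolor c [set x] i0) t i0 = [set x].
Proof.
move=> [cl _ nb _] xT tT tx i0C; apply/setP => v.
rewrite !inE /recolor in_set1 negb_and negbK.
have [->|vx] /= := eqVneq v x; first by rewrite eqxx cl.
apply/negP => /and3P[tv vT /eqP E]; case/negP: i0C; rewrite -E; exact: nb tv.
Qed.

Lemma singles_drop T c C x t i0 :
  config T c C -> x \in T -> t \in T -> t != x -> i0 \notin C ->
  singles (T :\ x) (recolor c [set x] i0) (i0 |: C) t = i0 |: singles T c C t.
Proof.
move=> cf xT tT tx i0C; apply/setP => i; rewrite !inE.
have [->|ii0] /= := eqVneq i i0; first by rewrite (cls_drop_new cf) // cards1.
by case iC: (i \in C) => //=; rewrite (cls_drop cf).
Qed.

Lemma singles_add T c C u j t :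
  config T c C -> u \notin T -> c u = j ->
  singles (u |: T) c (C :\ j) t = singles T c C t :\ j.
Proof.
move=> cf uT cu; apply/setP => i; rewrite !inE -andbA; have [//|ij] /= := eqVneq i j.
congr (_ && (_ == 1)); apply: eq_card => v; rewrite !inE negb_or.
have [->|//] := eqVneq v u.
have -> : c u == i = false by rewrite cu eq_sym (negbTE ij).
by rewrite !andbF.
Qed.

Lemma config_add_common T c C u j :
  config T c C -> u \notin T -> c u = j -> {in T, forall t, j \in singles T c C t} ->
  {in T, forall t, adj t u} -> (forall v, adj u v -> v \notin T -> c v \in C) ->
  config (u |: T) c (C :\ j).
Proof.
move=> cf uT cu jS Tu uC; have [x xT _] := config_other u cf.
apply: config_add => //; first exact: singlesC (jS x xT).
move=> t tT; apply: single_set (jS t tT) _.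
by apply/clsP; split=> //; apply: Tu.
Qed.

Lemma common_vertex T c C j :
  config T c C -> {in T, forall t, j \in singles T c C t} ->
  exists u, [/\ u \notin T, c u = j & {in T, forall t, adj t u}].
Proof.
move=> cf jS; have [x xT] : exists x, x \in T.
  by apply/card_gt0P; apply: leq_trans (config_gt1 cf).
have /card_gt0P[u uX] := cls_gt0 uncolorable cf xT (singlesC (jS x xT)).
have /clsP[_ uT cu] := uX; exists u; split=> // t tT.
exact: single_adj cf xT tT (jS x xT) uX.
Qed.

(* Trading [x] for [u]: [x] moves into the class of the unused colour [i0]. *)
Lemma config3_trade T c C x u j i0 :
  config T c C -> #|T| = 3 -> x \in T -> i0 \notin C ->
  u \notin T -> c u = j -> {in T, forall t, j \in singles T c C t} ->
  {in T, forall t, adj t u} ->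
  let T' := u |: (T :\ x) in let c' := recolor c [set x] i0 in
  let C' := (i0 |: C) :\ j in
  [/\ config T' c' C', #|T'| = 3,
      forall t, t \in T -> t != x -> singles T' c' C' t = (i0 |: singles T c C t) :\ j
    & i0 \in singles T' c' C' u -> forall v, v \notin T -> adj u v -> c v != i0].
Proof.
move=> cf T3 xT i0C uT cu jS Tu T' c' C'.
have cfx := config_drop cf xT i0C; rewrite -/c' in cfx.
have ux : u != x by apply: contraNneq uT => ->.
have c'u : c' u = j by rewrite /c' /recolor in_set1 (negbTE ux).
have uTx : u \notin T :\ x by rewrite !inE negb_and uT orbT.
have i0CT : i0 |: C = [set: 'I_6].
  apply/eqP; rewrite eqEcard subsetT cardsT card_ord cardsU1 i0C (card_colors cf) T3 //.
have cf' : config T' c' C'.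
  apply: config_add_common => //.
  - move=> t /setD1P[tx tT]; rewrite (singles_drop cf) // in_setU1 jS ?orbT //.
  - by move=> t /setD1P[_ tT]; apply: Tu.
  - by move=> v _ _; rewrite i0CT inE.
have T'3 : #|T'| = 3 by rewrite /T' cardsU1 uTx -T3 (cardsD1 x T) xT.
split=> //.
  move=> t tT tx; rewrite /T' /C' (singles_add t cfx uTx c'u) (singles_drop cf) //.
(* After the trade [x] is a neighbour of [u] coloured [i0]; if it is the only one, no neighbour of
   [u] outside [T] had this colour. *)
move=> i0u v vT uv; apply/eqP => cv.
have vx : v != x by apply: contraNneq vT => ->.
suff E : v = x by rewrite E eqxx in vx.
have uT' : u \in T' by rewrite setU11.
apply: (single_eq i0u); apply/clsP; rewrite /c' /recolor in_set1.
  rewrite (negbTE vx); split=> //; rewrite !inE negb_or negb_and vT orbT andbT.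
  by rewrite eq_sym; apply: adj_neq.
by rewrite eqxx; split; rewrite 1?adjC ?Tu // !inE negb_or negb_and negbK eqxx eq_sym ux.
Qed.

Lemma config3_free_color T c C : config T c C -> #|T| = 3 ->
  exists2 i0, i0 \notin C & forall i, i \in C :|: [set i0].
Proof.
move=> cf T3; have [i0 i0C] := config_free cf (eq_leq (esym T3)).
exists i0 => // i; have -> : C :|: [set i0] = [set: 'I_6]; last by rewrite inE.
apply/eqP; rewrite eqEcard subsetT cardsT card_ord setUC cardsU1 i0C.
by rewrite (card_colors cf) T3.
Qed.

(** Trade the third vertex [x] for [u] and let [k] be a common single class afterwards. If [k] is an
    old class, both [y] and [z] have exactly the single classes [j] and [k], against the assumption.
    If [k] is the spare colour [i0], then [u] does not see [i0] outside [T] and can be added. *)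
Lemma config3_extend_neq T c C y z :
  config T c C -> #|T| = 3 -> y \in T -> z \in T -> singles T c C y != singles T c C z ->
  exists T' c' C', @config G 6 T' c' C' /\ #|T'| = 4.
Proof.
move=> cf T3 yT zT Syz; have yz : y != z by apply: contraNneq Syz => ->.
have [x [xT yx zx TE]] := third T3 yT zT yz.
have [i0 i0C C_all] := config3_free_color cf T3.
have [j jS] := config3_common cf T3; have [u [uT cu Tu]] := common_vertex cf jS.
have [cf' T'3 S' free] := config3_trade cf T3 xT i0C uT cu jS Tu.
have [k kS] := config3_common cf' T'3.
have mem t : t \in T -> t != x -> k \in (i0 |: singles T c C t) :\ j.
  by move=> tT tx; rewrite -S' //; apply: (kS t); rewrite !inE tx tT orbT.
have [ki0|ki0] := eqVneq k i0.
  have i0u := kS u (setU11 _ _); rewrite {1}ki0 in i0u.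
  exists (u |: T), c, (C :\ j); split; last by rewrite cardsU1 uT T3.
  apply: config_add_common => // v uv vT; have := C_all (c v).
  by rewrite !inE (negbTE (free i0u v vT uv)) orbF.
have [kj ky] : k != j /\ k \in singles T c C y.
  by have := mem y yT yx; rewrite in_setD1 in_setU1 (negbTE ki0) => /andP[].
have kz : k \in singles T c C z.
  by have := mem z zT zx; rewrite in_setD1 in_setU1 (negbTE ki0) => /andP[].
case/negP: Syz; apply/eqP.
have S t : t \in T -> k \in singles T c C t -> singles T c C t = [set k; j].
  by move=> tT kt; apply: set2_eq => //; [apply: (jS t)|rewrite (card_singles_regular cf tT)
      T3].
by rewrite (S y) // (S z).
Qed.

(** After a trade, [i0] is single for the old vertices, through [x]. If it is also single for [u],
    then [u] can be added to [T]; if not, [config3_extend_neq] applies to the traded clique. *)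
Lemma config3_extend T c C :
  config T c C -> #|T| = 3 -> exists T' c' C', @config G 6 T' c' C' /\ #|T'| = 4.
Proof.
move=> cf T3; have [x xT] : exists x, x \in T by apply/card_gt0P; rewrite T3.
have [i0 i0C C_all] := config3_free_color cf T3.
have [j jS] := config3_common cf T3; have [u [uT cu Tu]] := common_vertex cf jS.
have [cf' T'3 S' free] := config3_trade cf T3 xT i0C uT cu jS Tu.
have [i0u|i0u] := boolP (i0 \in singles (u |: T :\ x) (recolor c [set x] i0) ((i0 |: C) :\ j)
    u).
  exists (u |: T), c, (C :\ j); split; last by rewrite cardsU1 uT T3.
  apply: config_add_common => // v uv vT; have := C_all (c v).
  by rewrite !inE (negbTE (free i0u v vT uv)) orbF.
have [y yT yx] := config_other x cf.
have ij : i0 != j by apply: contraNneq i0C => ->; apply: singlesC (jS x xT).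
apply: (config3_extend_neq cf' T'3 (y := y) (z := u)).
- by rewrite !inE yx yT orbT.
- exact: setU11.
- apply: contraNneq i0u => <-; rewrite S' // !inE ij eqxx //.
Qed.

(** * Cliques of four vertices *)

Lemma config4_mixed_singles T c C x y z i l :
  config T c C -> #|T| = 4 -> x \in T -> y \in T -> z \in T ->
  x != y -> x != z -> i \in singles T c C x -> i \in singles T c C y ->
  l \in singles T c C z -> l != i -> False.
Proof.
move=> cf T4 xT yT zT xy xz ix iy lz li; have [cl _ _ _] := cf.
have S1 t k : t \in T -> k \in singles T c C t -> singles T c C t = [set k].
  move=> tT kt; apply/esym/eqP; rewrite eqEcard sub1set kt cards1.
  by rewrite (card_singles_regular cf tT) T4.
have /card_gt0P[ui Xi] := cls_gt0 uncolorable cf xT (singlesC ix).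
have /card_gt0P[ul Zl] := cls_gt0 uncolorable cf zT (singlesC lz).
have /clsP[_ uiT ci] := Xi; have /clsP[_ ulT cl'] := Zl.
have [cli cardi] : clique (ui |: T) /\ #|ui |: T| = 5.
  apply: clique_setU1 => // v vT; rewrite adjC; exact: single_adj cf xT vT ix Xi.
have [cll cardl] : clique (ul |: (ui |: T)) /\ #|ul |: (ui |: T)| = 6.
  apply: clique_setU1 => //.
    by rewrite !inE negb_or ulT andbT; apply: contraNneq li => E; rewrite -cl' E ci.
  move=> v /setU1P[->|vT]; last by rewrite adjC; apply: single_adj cf zT vT lz Zl.
  by rewrite adjC; apply: (single_link uncolorable cf xT zT xz _ ix lz Xi Zl); rewrite eq_sym.
(* [C] has four classes. The two besides [i] and [l] are single for neither [x] nor [y] and contain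
   no vertex of the six-clique outside [T]. *)
have [k [v [kC kl kx vX yv]]] := other_nonnbr cf xT yT xy (singlesC lz).
have ki : k != i by apply: contraNneq kx => ->.
have [k' [k'C k'k k'li]] : exists k', [/\ k' \in C, k' \notin [set k] & k' \notin [set l; i]].
  by apply: exists_outside; rewrite cards1 cards2 li (card_colors cf) T4.
move: k'k k'li; rewrite !inE !negb_or => k'k /andP[k'l k'i].
have Px := S1 x i xT ix; have Py := S1 y i yT iy.
apply: (@clique6_false T c C (ul |: (ui |: T)) x y k k' v);
  rewrite // ?Px ?Py ?inE ?xT ?yT ?orbT //; first by rewrite eq_sym.
move=> t; rewrite !inE => /or3P[/eqP->|/eqP->|->//] _.
- by rewrite cl' !(eq_sym l) kl k'l.
- by rewrite ci !(eq_sym i) ki k'i.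
Qed.

Lemma config4_single T c C t i : config T c C -> #|T| = 4 -> t \in T ->
  i \in singles T c C t -> singles T c C t = [set i].
Proof.
move=> cf T4 tT it; apply/esym/eqP; rewrite eqEcard sub1set it cards1.
by rewrite (card_singles_regular cf tT) T4.
Qed.

(** Each vertex has exactly one single class. If two share theirs and a third differs,
    [config4_mixed_singles] applies; three different ones complete [T] to a K_7. *)
Lemma config4_common T c C : config T c C -> #|T| = 4 ->
  exists j, {in T, forall t, j \in singles T c C t}.
Proof.
move=> cf T4; have ex_single t : t \in T -> exists i, i \in singles T c C t.
  by move=> tT; apply/card_gt0P; rewrite (card_singles_regular cf tT) T4.
have [x xT] : exists x, x \in T by apply/card_gt0P; rewrite T4.
have [i ix] := ex_single x xT; exists i => w wT; apply: contraT => iw.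
have [l lw] := ex_single w wT; have li : l != i by apply: contraNneq iw => <-.
have il : i != l by rewrite eq_sym.
have xw : x != w by apply: contraNneq iw => <-.
have wx : w != x by rewrite eq_sym.
have [y [yT yx yw]] : exists y, [/\ y \in T, y \notin [set x] & y \notin [set w]].
  by apply: exists_outside; rewrite !cards1 T4.
move: yx yw; rewrite !inE !(eq_sym y) => xy wy.
have [iy|iy] := boolP (i \in singles T c C y).
  by case: (config4_mixed_singles cf T4 xT yT wT xy xw ix iy lw li).
have [ly|ly] := boolP (l \in singles T c C y).
  by case: (config4_mixed_singles cf T4 wT yT xT wy wx lw ly ix il).
have [r ry] := ex_single y yT.
have ri : r != i by apply: contraNneq iy => <-.
have rl : r != l by apply: contraNneq ly => <-.
have /card_gt0P[ui Xi] := cls_gt0 uncolorable cf xT (singlesC ix).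
have /card_gt0P[ul Wl] := cls_gt0 uncolorable cf wT (singlesC lw).
have /card_gt0P[ur Yr] := cls_gt0 uncolorable cf yT (singlesC ry).
have /clsP[_ uiT ci] := Xi; have /clsP[_ ulT cl'] := Wl; have /clsP[_ urT cr] := Yr.
have [cli cardi] : clique (ui |: T) /\ #|ui |: T| = 5.
  apply: clique_setU1 => //; first by case: cf.
  by move=> v vT; rewrite adjC; apply: single_adj cf xT vT ix Xi.
have [cll cardl] : clique (ul |: (ui |: T)) /\ #|ul |: (ui |: T)| = 6.
  apply: clique_setU1 => //.
    by rewrite !inE negb_or ulT andbT; apply: contraNneq li => E; rewrite -cl' E ci.
  move=> v /setU1P[->|vT]; last by rewrite adjC; apply: single_adj cf wT vT lw Wl.
  exact: (single_link uncolorable cf wT xT wx li lw ix Wl Xi).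
have [yx yw] : y != x /\ y != w by rewrite !(eq_sym y).
have [clr cardr] : clique (ur |: (ul |: (ui |: T))) /\ #|ur |: (ul |: (ui |: T))| = 7.
  apply: clique_setU1 => //.
    rewrite !inE !negb_or urT andbT; apply/andP; split.
      by apply: contraNneq rl => E; rewrite -cr E cl'.
    by apply: contraNneq ri => E; rewrite -cr E ci.
  move=> v /setU1P[->|/setU1P[->|vT]].
  - exact: single_link cf yT wT yw rl ry lw Yr Wl.
  - exact: single_link cf yT xT yx ri ry ix Yr Xi.
  - by rewrite adjC; apply: single_adj cf yT vT ry Yr.
by have := no_K7 clr; rewrite cardr.
Qed.

(** Replace [w] by [u], moving [w] to colour [i1]. As [j] is gone, the common single class must be
    [i1], so [u] does not see [i1] outside [T] either, and [T] with [u] is a configuration of five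
    vertices. *)
Lemma config4_unseen_color T c C u j i0 i1 :
  config T c C -> #|T| = 4 -> i0 \notin C -> i1 \notin C -> i0 != i1 ->
  u \notin T -> c u = j -> {in T, forall t, j \in singles T c C t} ->
  {in T, forall t, adj t u} ->
  (forall v, v \notin T -> adj u v -> c v != i0) -> False.
Proof.
move=> cf T4 i0C i1C i01 uT cu jS Tu free0.
have C_all k : k != i0 -> k != i1 -> k \in C.
  move=> k0 k1; apply: contraT => kC; have := card_colors cf; rewrite T4 => C4.
  have := subset_leq_card (subsetT (k |: (i0 |: (i1 |: C)))).
  by rewrite cardsT card_ord !cardsU1 !inE !negb_or k0 k1 kC i01 i0C i1C C4.
have [w wT] : exists w, w \in T by apply/card_gt0P; rewrite T4.
have [y yT yw] := config_other w cf.
pose c1 := recolor c [set w] i1; have cf1 := config_drop cf wT i1C; rewrite -/c1 in cf1.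
have uw : u != w by apply: contraNneq uT => ->.
have c1u : c1 u = j by rewrite /c1 /recolor in_set1 (negbTE uw).
have uTw : u \notin T :\ w by rewrite in_setD1 negb_and uT orbT.
have cf1u : config (u |: T :\ w) c1 ((i1 |: C) :\ j).
  apply: config_add_common => //.
  - by move=> t /setD1P[tw tT]; rewrite (singles_drop cf) // in_setU1 (jS t tT) orbT.
  - by move=> t /setD1P[_ tT]; apply: Tu.
  - move=> v uv; rewrite in_setD1 negb_and negbK /c1 /recolor in_set1 in_setU1.
    have [_ _|vw /= vT] := eqVneq v w; first by rewrite eqxx.
    have [//|v1 /=] := eqVneq (c v) i1; apply: C_all => //; exact: free0.
have T'4 : #|u |: T :\ w| = 4 by rewrite cardsU1 uTw -T4 (cardsD1 w T) wT.
have [k kS] := config4_common cf1u T'4.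
have ki1 : k = i1.
  have yT' : y \in u |: T :\ w by rewrite !inE yw yT orbT.
  have := kS y yT'; rewrite (singles_add y cf1 uTw c1u) (singles_drop cf) //.
  rewrite (config4_single cf T4 yT (jS y yT)) !inE.
  by case/andP => /negbTE-> /orP[/eqP|].
have i1u := kS u (setU11 _ _); rewrite ki1 in i1u.
apply: (config5_false (T := u |: T) (c := c) (C := C :\ j)); last by rewrite cardsU1 uT T4.
apply: config_add_common => // v uv vT; apply: C_all; first exact: free0.
apply/eqP => cv; have vw : v != w by apply: contraNneq vT => ->.
suff E : v = w by rewrite E eqxx in vw.
apply: (single_eq i1u); apply/clsP; rewrite /c1 /recolor in_set1.
  rewrite (negbTE vw); split=> //; rewrite !inE negb_or negb_and vT orbT andbT.
  by rewrite eq_sym; apply: adj_neq.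
by rewrite eqxx; split; rewrite 1?adjC ?Tu // !inE negb_or negb_and negbK eqxx eq_sym uw.
Qed.

(** Move [w] into class [i1], then trade [x] for [u] using [i0]. The common single class of the
    resulting three vertices can only be [i0] or [i1], and [u] does not see that colour outside
    [T]. *)
Lemma config4_false T c C : config T c C -> #|T| = 4 -> False.
Proof.
move=> cf T4; have [j jS] := config4_common cf T4.
have [u [uT cu Tu]] := common_vertex cf jS.
have [i0 [i1 [i0C i1C i01]]] : exists i0 i1, [/\ i0 \notin C, i1 \notin C & i0 != i1].
  have /card_gt1P[i0 [i1 [H0 H1 H]]] : 1 < #|~: C|.
    by rewrite -(leq_add2l #|C|) cardsC card_ord (card_colors cf) T4.
  by exists i0, i1; rewrite !inE in H0 H1.
have [w wT] : exists w, w \in T by apply/card_gt0P; rewrite T4.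
pose c3 := recolor c [set w] i1; have cf3 := config_drop cf wT i1C; rewrite -/c3 in cf3.
have T3 : #|T :\ w| = 3 by move: T4; rewrite (cardsD1 w) wT add1n => -[].
have [x xT3] : exists x, x \in T :\ w by apply/card_gt0P; rewrite T3.
have [y yT3 yx] := config_other x cf3.
have uw : u != w by apply: contraNneq uT => ->.
have cu3 : c3 u = j by rewrite /c3 /recolor in_set1 (negbTE uw).
have uT3 : u \notin T :\ w by rewrite in_setD1 negb_and uT orbT.
have jS3 : {in T :\ w, forall t, j \in singles (T :\ w) c3 (i1 |: C) t}.
  by move=> t /setD1P[tw tT]; rewrite (singles_drop cf) // in_setU1 (jS t tT) orbT.
have Tu3 : {in T :\ w, forall t, adj t u} by move=> t /setD1P[_ tT]; apply: Tu.
have i0C3 : i0 \notin i1 |: C by rewrite !inE negb_or i01.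
have [cf' T'3 S' free] := config3_trade cf3 T3 xT3 i0C3 uT3 cu3 jS3 Tu3.
have [k kS] := config3_common cf' T'3; have ku := kS u (setU11 _ _).
have /setD1P[yw yT] := yT3; have /setD1P[xw xT] := xT3.
have [ki0|ki1] : k = i0 \/ k = i1.
  have yT' : y \in u |: T :\ w :\ x by rewrite in_setU1 in_setD1 yx yT3 orbT.
  have := kS y yT'; rewrite S' // (singles_drop cf) // (config4_single cf T4 yT (jS y yT)).
  by rewrite !inE => /andP[/negbTE->]; rewrite orbF => /orP[]/eqP; [left|right].
- apply: (config4_unseen_color cf T4 i0C i1C i01 uT cu jS Tu) => v vT uv.
  have vw : v != w by apply: contraNneq vT => ->.
  rewrite {1}ki0 in ku; have := free ku v; rewrite in_setD1 negb_and vT orbT.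
  by rewrite /c3 /recolor in_set1 (negbTE vw) => /(_ isT uv).
- have i10 : i1 != i0 by rewrite eq_sym.
  apply: (config4_unseen_color cf T4 i1C i0C i10 uT cu jS Tu) => v vT uv; apply/eqP => cv.
  have vw : v != w by apply: contraNneq vT => ->.
  have vx : v != x by apply: contraNneq vT => ->.
  suff E : v = w by rewrite E eqxx in vw.
  rewrite {1}ki1 in ku; apply: (single_eq ku); apply/clsP; rewrite /c3 /recolor !in_set1.
    rewrite (negbTE vx) (negbTE vw); split=> //; rewrite !inE !negb_or !negb_and vT !orbT andbT.
    by rewrite eq_sym; apply: adj_neq.
  rewrite eq_sym (negbTE xw) eqxx; split; rewrite 1?adjC ?Tu //.
  by rewrite !inE negb_or !negb_and !negbK eqxx eq_sym uw orbT.
Qed.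

Lemma config3_false T c C : config T c C -> #|T| = 3 -> False.
Proof.
move=> cf T3; have [T' [c' [C' [cf' T'4]]]] := config3_extend cf T3.
exact: config4_false cf' T'4.
Qed.

(** * Edges, as cliques of two vertices *)

Lemma config2_colors T c C : config T c C -> #|T| = 2 -> C = [set: 'I_6].
Proof.
by move=> cf T2; apply/eqP; rewrite eqEcard subsetT cardsT card_ord (card_colors cf) T2.
Qed.

(** An edge leaves no spare colour, so a common single neighbour can be added at once. *)
Lemma config2_disjoint T c C x y j :
  config T c C -> #|T| = 2 -> x \in T -> y \in T -> x != y ->
  j \in singles T c C x -> j \in singles T c C y -> False.
Proof.
move=> cf T2 xT yT xy jx jy.
have jS : {in T, forall t, j \in singles T c C t}.
  by move=> t; rewrite {1}(set2_eq xT yT xy (eq_leq T2)) => /set2P[]->.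
have [u [uT cu Tu]] := common_vertex cf jS.
apply: (config3_false (T := u |: T) (c := c) (C := C :\ j)); last by rewrite cardsU1 uT T2.
by apply: config_add_common => // v _ _; rewrite (config2_colors cf T2) inE.
Qed.

Lemma config2_complement T c C x y i :
  config T c C -> #|T| = 2 -> x \in T -> y \in T -> x != y ->
  (i \in singles T c C y) = (i \notin singles T c C x).
Proof.
move=> cf T2 xT yT xy.
have -> : singles T c C y = ~: singles T c C x; last by rewrite inE.
apply/eqP; rewrite eqEcard; apply/andP; split.
  by apply/subsetP => k ky; rewrite inE; apply/negP => kx;
      apply: (config2_disjoint cf T2 xT yT xy kx ky).
by rewrite -(leq_add2l #|singles T c C x|) cardsC card_ord !(card_singles_regular cf) // T2.
Qed.

(* A vertex of [nonnbr x y] misses [y] and its partner in its class, so it can be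
   a nonneighbour of only one single neighbour of [x]. As [nonnbr x y] has at most
   three vertices, this forces nonadjacencies between the single neighbours. *)
Lemma config2_path T c C x y :
  config T c C -> #|T| = 2 -> x \in T -> y \in T -> x != y ->
  exists p1 p2 p3 u1 u2 u3 b1 b3,
  [/\ [/\ p1 \in singles T c C x, p2 \in singles T c C x, p3 \in singles T c C x,
         p1 != p2 & p2 != p3] /\ p1 != p3,
      [/\ u1 \in cls T c x p1, u2 \in cls T c x p2 & u3 \in cls T c x p3],
      u1 \in nonnbr x u2 /\ u3 \in nonnbr x u2,
      [/\ b1 \in nonnbr x y, b3 \in nonnbr x y & b1 != b3] &
      b1 \in nonnbr x u1 /\ b3 \in nonnbr x u3].
Proof.
move=> cf T2 xT yT xy; have [cl _ _ _] := cf; have axy := cl _ _ xT yT xy.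
have S3 : #|singles T c C x| = 3 by rewrite (card_singles_regular cf xT) T2.
have yx : y != x by rewrite eq_sym.
(* If the class of [v] is not single for [x], it is single for [y]; were [v] adjacent to [y],
   [single_link] would make it adjacent to [u]. *)
have out p u v : p \in singles T c C x -> u \in cls T c x p -> v \in nonnbr x u ->
    (exists2 q, q \in singles T c C x & v \in cls T c x q) \/ v \in nonnbr x y.
  move=> px uX vN; have [k kC vX] := nonnbr_single cf xT xT px uX vN.
  have [kx|kx] := boolP (k \in singles T c C x); [by left; exists k | right].
  have ky : k \in singles T c C y by rewrite (config2_complement k cf T2 xT yT xy).
  have /nonnbrP[xv vu uv] := vN; have /clsP[_ vT cv] := vX.
  apply/nonnbrP; split=> //; first by apply: contraNneq vT => ->.
  apply: contraNN uv => yv; have vY := mem_cls_of_adj yT vX yv.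
  apply: (single_link uncolorable cf xT yT xy _ px ky uX vY).
  by apply: contraTneq ky => <-; rewrite (config2_complement p cf T2 xT yT xy) negbK.
have disj p p' u u' b : p \in singles T c C x -> p' \in singles T c C x -> p != p' ->
    u \in cls T c x p -> u' \in cls T c x p' -> b \in nonnbr x y ->
    b \in nonnbr x u -> b \in nonnbr x u' -> False.
  move=> px p'x pp' uX u'X bN bu bu'; have [k kC bX] := nonnbr_cls cf xT yT bN.
  have /nonnbrP[xb _ yb] := bN.
  have kx := single_of_not_adj uncolorable cf xT yT kC bX yb.
  have ky : k \in singles T c C y by rewrite (config2_complement k cf T2 xT yT xy).
  have /card_gt0P[q qY] := cls_gt0 uncolorable cf yT kC.
  have qX := single_common uncolorable cf yT xT ky qY.
  have bq : b != q by apply: contraNneq yb => ->; case/clsP: qY.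
  have ne v w r : v \in cls T c x r -> w \in T -> w != v.
    by move=> /clsP[_ vT _] wT; apply: contraNneq vT => <-.
  have nc v v' r r' : v \in cls T c x r -> v' \in cls T c x r' -> r != r' -> v != v'.
    by move=> /clsP[_ _ cv] /clsP[_ _ cv']; apply: contra_neq => E; rewrite -cv -cv' E.
  have pk : p != k by apply: contraNneq kx => <-.
  have p'k : p' != k by apply: contraNneq kx => <-.
  have := @nonnbr_le3 x b [:: y; u; u'; q] xb; rewrite /= !in_cons in_nil !orbF !negb_or.
  rewrite (ne _ _ _ uX yT) (ne _ _ _ u'X yT) (ne _ _ _ qX yT) (nc _ _ _ _ uX u'X pp').
  rewrite (nc _ _ _ _ uX qX pk) (nc _ _ _ _ u'X qX p'k) /=.
  rewrite (nonnbr_sym axy bN) (nonnbr_sym _ bu) ?(nonnbr_sym _ bu'); try by case/clsP: uX;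
      case/clsP: u'X.
  rewrite (cls_mate cf bX qX) 1?eq_sym //; by move=> /(_ isT isT).
(* If [u] were adjacent to both [v] and [w], then two vertices missing [u], one missing [v] and one
   missing [w] would be four distinct members of [nonnbr x y]. *)
have inner p p' q u v w : p \in singles T c C x -> p' \in singles T c C x ->
    q \in singles T c C x -> p != p' -> p != q -> p' != q ->
    u \in cls T c x p -> v \in cls T c x p' -> w \in cls T c x q ->
    (v \in nonnbr x u) || (w \in nonnbr x u).
  move=> px p'x qx pp' pq p'q uX vX wX; apply: contraT; rewrite negb_or => /andP[vu wu].
  have SE k : k \in singles T c C x -> [|| k == p, k == p' | k == q].
    have <- : [set p; p'; q] = singles T c C x.
      apply/eqP; rewrite eqEcard S3 !subUset !sub1set px p'x qx /=.
      by rewrite setUC cardsU1 cards2 !inE negb_or pp' !(eq_sym q) pq p'q.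
    by rewrite !inE orbA.
  have all_out t : t \in nonnbr x u -> t \in nonnbr x y.
    move=> tu; case: (out p u t px uX tu) => // -[k kx tX].
    case/or3P: (SE k kx) => /eqP E; rewrite E in tX kx.
    - by case/nonnbrP: tu => _; rewrite (single_eq kx tX uX) eqxx.
    - by rewrite (single_eq kx tX vX) (negbTE vu) in tu.
    - by rewrite (single_eq kx tX wX) (negbTE wu) in tu.
  have [xu xv xw] : [/\ adj x u, adj x v & adj x w] by case/clsP: uX; case/clsP: vX;
      case/clsP: wX.
  have one r r' s s' : r \in singles T c C x -> s \in cls T c x r -> s' \in cls T c x r' ->
      (forall k, k \in singles T c C x -> [|| k == r, k == r' | k == p]) -> s \notin nonnbr x
          u ->
      r' \in singles T c C x -> adj x s -> exists2 b, b \in nonnbr x y & b \in nonnbr x s.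
    move=> rx sX s'X rE su r'x xs; have [b bs bs'] := nonnbr_other s' xs.
    exists b => //; case: (out r s b rx sX bs) => // -[k kx bX].
    case/or3P: (rE k kx) => /eqP E; rewrite E in bX kx.
    - by case/nonnbrP: bs => _; rewrite (single_eq kx bX sX) eqxx.
    - by rewrite (single_eq kx bX s'X) eqxx in bs'.
    - by rewrite (single_eq kx bX uX) in bs; rewrite (nonnbr_sym xs bs) in su.
  have [a aN _] := nonnbr_other x xu; have [b bN ba] := nonnbr_other a xu.
  have [d dy dv] : exists2 d, d \in nonnbr x y & d \in nonnbr x v.
    by apply: (one p' q v w) => // k /SE/or3P[]->; rewrite ?orbT.
  have [e ey ew] : exists2 e, e \in nonnbr x y & e \in nonnbr x w.
    by apply: (one q p' w v) => // k /SE/or3P[]->; rewrite ?orbT.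
  have ay := all_out _ aN; have b_y := all_out _ bN.
  have := @nonnbr_le3 x y [:: a; b; d; e] axy; rewrite /= !in_cons in_nil !orbF !negb_or.
  have -> : a != b by rewrite eq_sym.
  have -> : a != d by apply/eqP => E; apply: (disj p p' u v a); rewrite // E.
  have -> : a != e by apply/eqP => E; apply: (disj p q u w a); rewrite // E.
  have -> : b != d by apply/eqP => E; apply: (disj p p' u v b); rewrite // E.
  have -> : b != e by apply/eqP => E; apply: (disj p q u w b); rewrite // E.
  have -> : d != e by apply/eqP => E; apply: (disj p' q v w d); rewrite // E.
  by rewrite ay b_y dy ey => /(_ isT isT).
have finish p1 p2 p3 u1 u2 u3 : p1 \in singles T c C x -> p2 \in singles T c C x ->
    p3 \in singles T c C x -> p1 != p2 -> p2 != p3 -> p1 != p3 ->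
    u1 \in cls T c x p1 -> u2 \in cls T c x p2 -> u3 \in cls T c x p3 ->
    u1 \in nonnbr x u2 -> u3 \in nonnbr x u2 ->
    (exists2 b, b \in nonnbr x y & b \in nonnbr x u1).
  move=> p1x p2x p3x p12 p23 p13 X1 X2 X3 n12 n32.
  have xu1 : adj x u1 by case/clsP: X1.
  have [b bN b2] := nonnbr_other u2 xu1; exists b => //.
  case: (out p1 u1 b p1x X1 bN) => // -[k kx bX].
  have : [|| k == p1, k == p2 | k == p3].
    have E : [set p1; p2; p3] = singles T c C x.
      apply/eqP; rewrite eqEcard S3 !subUset !sub1set p1x p2x p3x /=.
      by rewrite setUC cardsU1 cards2 !inE negb_or p12 !(eq_sym p3) p13 p23.
    by move: kx; rewrite -E !inE orbA.
  case/or3P => /eqP E; rewrite E in bX kx.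
  - by case/nonnbrP: bN => _; rewrite (single_eq kx bX X1) eqxx.
  - by rewrite (single_eq kx bX X2) eqxx in b2.
  - have xu2 : adj x u2 by case/clsP: X2.
    rewrite (single_eq kx bX X3) in bN.
    by case: (nonnbr_triangle claw xu2 n12 n32 bN).
have result p1 p2 p3 u1 u2 u3 : p1 \in singles T c C x -> p2 \in singles T c C x ->
    p3 \in singles T c C x -> p1 != p2 -> p2 != p3 -> p1 != p3 ->
    u1 \in cls T c x p1 -> u2 \in cls T c x p2 -> u3 \in cls T c x p3 ->
    u1 \in nonnbr x u2 -> u3 \in nonnbr x u2 -> exists b1 b3,
    [/\ b1 \in nonnbr x y, b3 \in nonnbr x y & b1 != b3] /\
    (b1 \in nonnbr x u1 /\ b3 \in nonnbr x u3).
  move=> p1x p2x p3x p12 p23 p13 X1 X2 X3 n12 n32.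
  have [b1 b1y b1u] := finish p1 p2 p3 u1 u2 u3 p1x p2x p3x p12 p23 p13 X1 X2 X3 n12 n32.
  have [p32 p21 p31] : [/\ p3 != p2, p2 != p1 & p3 != p1] by split; rewrite eq_sym.
  have [b3 b3y b3u] := finish p3 p2 p1 u3 u2 u1 p3x p2x p1x p32 p21 p31 X3 X2 X1 n32 n12.
  exists b1, b3; split=> //; split=> //; apply/eqP => E; rewrite -E in b3u.
  exact: (disj p1 p3 u1 u3 b1).
have /card_gt2P[p1 [p2 [p3 [[p1x p2x p3x] [p12 p23 p31]]]]] : 2 < #|singles T c C x| by
    rewrite S3.
have p13 : p1 != p3 by rewrite eq_sym.
have p21 : p2 != p1 by rewrite eq_sym.
have p32 : p3 != p2 by rewrite eq_sym.
have /card_gt0P[u1 X1] := cls_gt0 uncolorable cf xT (singlesC p1x).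
have /card_gt0P[u2 X2] := cls_gt0 uncolorable cf xT (singlesC p2x).
have /card_gt0P[u3 X3] := cls_gt0 uncolorable cf xT (singlesC p3x).
have xu p u : u \in cls T c x p -> adj x u by case/clsP.
(* By [inner], each of the three single neighbours misses another one, so nonadjacency contains a
   path on them; its middle vertex takes the role of [u2]. *)
have [n12|n12] := boolP (u2 \in nonnbr x u1).
  have n21 := nonnbr_sym (xu _ _ X1) n12.
  case/orP: (inner p3 p1 p2 u3 u1 u2 p3x p1x p2x p31 p32 p12 X3 X1 X2) => n3.
    have n31 := nonnbr_sym (xu _ _ X3) n3.
    have [b1 [b3 [H1 H2]]] := result p2 p1 p3 u2 u1 u3 p2x p1x p3x p21 p13 p23 X2 X1 X3 n12 n31.
    by exists p2, p1, p3, u2, u1, u3, b1, b3.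
  have n32 := nonnbr_sym (xu _ _ X3) n3.
  have [b1 [b3 [H1 H2]]] := result p1 p2 p3 u1 u2 u3 p1x p2x p3x p12 p23 p13 X1 X2 X3 n21 n32.
  by exists p1, p2, p3, u1, u2, u3, b1, b3.
have n13 : u3 \in nonnbr x u1.
  by have := inner p1 p2 p3 u1 u2 u3 p1x p2x p3x p12 p13 p23 X1 X2 X3; rewrite (negbTE n12).
have n23 : u3 \in nonnbr x u2.
  have := inner p2 p1 p3 u2 u1 u3 p2x p1x p3x p21 p23 p13 X2 X1 X3.
  by case/orP => // n21; move: n12; rewrite (nonnbr_sym (xu _ _ X2) n21).
have n31 := nonnbr_sym (xu _ _ X1) n13; have n32 := nonnbr_sym (xu _ _ X2) n23.
have [b1 [b3 [H1 H2]]] := result p1 p3 p2 u1 u3 u2 p1x p3x p2x p13 p32 p12 X1 X3 X2 n31 n32.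
by exists p1, p3, p2, u1, u3, u2, b1, b3.
Qed.

(** As [v] is the only neighbour of [y] coloured [j], the vertex [y] can take this colour once [v]
    is deleted in its place. *)
Lemma config2_swap T c C x y j v :
  config T c C -> #|T| = 2 -> x \in T -> y \in T -> x != y ->
  j \in singles T c C y -> v \in cls T c y j ->
  [/\ config [set x; v] (recolor c [set y] j) C, #|[set x; v]| = 2, x != v &
    forall k, k != j -> cls [set x; v] (recolor c [set y] j) x k = cls T c x k].
Proof.
move=> cf T2 xT yT xy jy vY; have [cl pr _ _] := cf.
have vX := single_common uncolorable cf yT xT jy vY.
have /clsP[xv vT cv] := vX; have TE := set2_eq xT yT xy (eq_leq T2).
have nxv := adj_neq xv; have C_all := config2_colors cf T2.
have vx : v != x by rewrite eq_sym.
have vy : v != y by apply: contraNneq vT => ->.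
split=> //; last 2 first.
- by rewrite cards2 nxv.
- move=> k kj; apply/setP => w; rewrite !inE TE !inE /recolor in_set1 !negb_or.
  have [->|wy] := eqVneq w y; first by rewrite (eq_sym j) (negbTE kj) /= !andbF.
  have [->|wv] := eqVneq w v; last by rewrite andbT.
  by rewrite cv (eq_sym j) (negbTE kj) !andbF.
split; last by rewrite C_all cardsT card_ord cards2 nxv.
- move=> s t; rewrite !inE => /orP[]/eqP-> /orP[]/eqP->; rewrite ?eqxx //.
  by rewrite adjC.
- have -> : [set x; v] = (v |: T) :\ y.
    by apply/setP => w; rewrite TE !inE; case: (eqVneq w y) => [->|_] /=;
        rewrite ?(negbTE xy) ?orbF 1?orbC // !(eq_sym y) (negbTE xy) (negbTE vy).
  apply: recolor_proper.
  + by move=> s t; rewrite !in_setU1 !negb_or => /andP[_ sT] /andP[_ tT]; apply: pr.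
  + by move=> s t /set1P-> /set1P->; rewrite adj_irrefl.
  + move=> s t /set1P->; rewrite in_setU1 negb_or => /andP[tv tT] _ ct.
    by apply: contraNN tv => yt; apply/eqP/(single_eq jy _ vY)/clsP.
- by move=> s t _ _ _; rewrite C_all inE.
Qed.

(** Replace [y] by the middle vertex [v2] of its path; the single classes of the two ends do not
    change. In class [q1], [x] has the neighbours [v1], adjacent to [y], and [e], the single
    neighbour of [v2]. If [b1] were there it would be [e], but [single_link] makes [e] adjacent to
    [u1]. The same holds for [q3] and for [b3], so [b1] and [b3] both lie in class [q2], where only
    one neighbour of [x] can miss [y]. *)
Lemma config2_false T c C : config T c C -> #|T| = 2 -> False.
Proof.
move=> cf T2; have [x xT] : exists x, x \in T by apply/card_gt0P; rewrite T2.
have [y yT yx] := config_other x cf; have xy : x != y by rewrite eq_sym.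
have [p1 [p2 [p3 [u1 [u2 [u3 [b1 [b3 [[[p1x _ p3x _ _] _] [X1 _ X3] _ [b1y b3y b13] [b1u
    b3u]]]]]]]]]] :=
  config2_path cf T2 xT yT xy.
have [q1 [q2 [q3 [v1 [v2 [v3 [_ [_ [[[q1y q2y q3y q12 q23] q13] [Y1 Y2 Y3] [n12 n32] _
    _]]]]]]]]] :=
  config2_path cf T2 yT xT yx.
have [cf' T'2 xv2 clsE] := config2_swap cf T2 xT yT xy q2y Y2.
set T' := [set x; v2] in cf' T'2 clsE; set c' := recolor c [set y] q2 in cf' clsE.
have [xT' vT'] : x \in T' /\ v2 \in T' by rewrite !inE !eqxx orbT.
have comp k := config2_complement k cf T2 xT yT xy.
have singE k : k \in singles T c C x -> k \in singles T' c' C x.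
  move=> kx; have kq : k != q2 by apply: contraTneq q2y => <-; rewrite comp kx.
  by move: kx; rewrite !inE (clsE _ kq).
have SE : singles T' c' C x = singles T c C x.
  apply/esym/eqP; rewrite eqEcard; apply/andP; split; first by apply/subsetP => k /singE.
  by rewrite (card_singles_regular cf xT) (card_singles_regular cf' xT') T2 T'2.
have comp' k := config2_complement k cf' T'2 xT' vT' xv2.
have far q v p u b : q \in singles T c C y -> v \in cls T c y q -> v \in nonnbr y v2 -> q !=
    q2 ->
    p \in singles T c C x -> u \in cls T c x p -> b \in nonnbr x y -> b \in nonnbr x u ->
    b \notin cls T c x q.
  move=> qy vY vN qq2 px uX bN bu; apply/negP => bX.
  have qv : q \in singles T' c' C v2 by rewrite comp' SE -comp.
  have /card_gt0P[e eV] := cls_gt0 uncolorable cf' vT' (singlesC qv).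
  have eX := single_common uncolorable cf' vT' xT' qv eV; rewrite clsE // in eX.
  have vX := single_common uncolorable cf yT xT qy vY.
  have /clsP[v2e _ _] := eV.
  have ev : e != v by apply: contraTneq v2e => ->; case/nonnbrP: vN.
  have be : b = e.
    have /nonnbrP[_ _ yb] := bN.
    by case: (cls_two claw cf eX vX ev bX) => // E; move: yb; rewrite E; case/clsP: vY => ->.
  have px' := singE p px.
  have pq : p != q by apply: contraTneq qy => <-; rewrite comp px.
  have uX' : u \in cls T' c' x p.
    by rewrite clsE //; apply: contraTneq q2y => <-; rewrite comp px.
  have := single_link uncolorable cf' xT' vT' xv2 pq px' qv uX' eV.
  by rewrite -be; case/nonnbrP: bu => _ _ /negbTE->.
have q32 : q3 != q2 by rewrite eq_sym.
have mid b p u : b \in nonnbr x y -> p \in singles T c C x -> u \in cls T c x p ->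
    b \in nonnbr x u -> b \in cls T c x q2.
  move=> bN px uX bu; have [k kC bX] := nonnbr_cls cf xT yT bN.
  have f1 := far q1 v1 p u b q1y Y1 n12 q12 px uX bN bu.
  have f3 := far q3 v3 p u b q3y Y3 n32 q32 px uX bN bu.
  have ky : k \in singles T c C y.
    by rewrite comp; case/nonnbrP: bN => _ _; apply: single_of_not_adj cf xT yT kC bX.
  have E : [set q1; q2; q3] = singles T c C y.
    apply/eqP; rewrite eqEcard (card_singles_regular cf yT) T2 !subUset !sub1set q1y q2y q3y /=.
    by rewrite setUC cardsU1 cards2 !inE negb_or q12 !(eq_sym q3) q13 q23.
  move: ky; rewrite -E !in_setU !in_set1 -orbA => /or3P[]/eqP Ek; move: bX; rewrite Ek //.
    by rewrite (negbTE f1).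
  by rewrite (negbTE f3).
have := nonnbr_cls_inj uncolorable claw cf xT yT xy (singlesC q2y) b1y b3y
  (mid _ _ _ b1y p1x X1 b1u) (mid _ _ _ b3y p3x X3 b3u).
by move/eqP; rewrite (negbTE b13).
Qed.

End Regular.

(** * Degrees *)

Section Critical.
Variables (G : sgraph) (m : nat).
Hypothesis uncolorable :
  forall (D : finType) (f : G -> D), #|D| <= m.+1 -> ~ proper_off set0 f.
Hypothesis edge_colorable : forall x y : G, adj x y ->
  exists c : G -> 'I_m, proper_off [set x; y] c.
Hypothesis claw : no_claw G.
Hypothesis no_isolated : forall x : G, exists y, adj x y.
Hypothesis incomplete : exists x y : G, x != y /\ ~~ adj x y.
Implicit Types (K : {set G}) (c : G -> 'I_m) (x y z u v w : G) (i j k : 'I_m).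

Definition universal x := [forall v, (v != x) ==> adj x v].

Lemma edge_config x y : adj x y -> exists c, config [set x; y] c setT.
Proof.
move=> xy; have [c pr] := edge_colorable xy; exists c; split=> //.
- by move=> u v /set2P[]-> /set2P[]->; rewrite ?eqxx // adjC.
- by move=> u v _ _ _; rewrite inE.
- by rewrite cards2 adj_neq // cardsT card_ord.
Qed.

(** * Clique number *)

Lemma clique_meets_edge K z w : clique K -> m < #|K| -> adj z w -> (z \in K) || (w \in K).
Proof.
move=> clK mK zw; have [c pr] := edge_colorable zw; apply: contraLR mK.
rewrite negb_or -leqNgt => /andP[zK wK]; rewrite -[m in _ <= m]card_ord.
have cinj : {in K &, injective c}.
  move=> u v uK vK cuv; apply/eqP; apply: contraT => uv.
  have off t : t \in K -> t \notin [set z; w].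
    by move=> tK; rewrite !inE negb_or; apply/andP; split;
        [apply: contraNneq zK|apply: contraNneq wK] => <-.
  by have := pr u v (off u uK) (off v vK) (clK u v uK vK uv); rewrite cuv eqxx.
by rewrite -(card_in_imset cinj) max_card.
Qed.

(** If [L] had more than m + 1 vertices, removing one end of an edge that leaves [L] would give a
    clique of more than [m] vertices avoiding that edge. If [K] has m + 1, the vertices outside are
    independent and each can copy a nonneighbour in [K]: a colouring by the vertices of [K]. *)
Lemma clique_card K : clique K -> #|K| <= m.
Proof.
have small (L : {set G}) : clique L -> #|L| <= m.+1.
  move=> clL; rewrite leqNgt; apply/negP => mL.
  have [z zL] : exists z, z \notin L.
    apply/existsP; rewrite -negb_forall; apply/negP => /forallP allL.
    by have [u [v [uv]]] := incomplete; rewrite clL // allL.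
  have [w zw] := no_isolated z.
  have := clique_meets_edge clL (ltnW mL) zw; rewrite (negbTE zL) /= => wL.
  have clLw : clique (L :\ w) by move=> u v /setD1P[_ uL] /setD1P[_ vL]; apply: clL.
  have mLw : m < #|L :\ w| by move: mL; rewrite (cardsD1 w L) wL add1n ltnS.
  have := clique_meets_edge clLw mLw zw.
  by rewrite !inE eqxx (negbTE zL) andbF.
move=> clK; rewrite leqNgt; apply/negP => mK.
pose f z := if z \in K then z else odflt z [pick k in K | ~~ adj z k].
have fP z : f z \in K /\ (z \notin K -> ~~ adj z (f z)).
  rewrite /f; case: ifP => [//|zK]; case: pickP => [k /andP[kK zk]//|no].
  have clz : clique (z |: K).
    have zA u : u \in K -> adj z u.
      by move=> uK; have /= := no u; rewrite uK => /negbFE.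
    move=> u v /setU1P[->|uK] /setU1P[->|vK]; rewrite ?eqxx //; last exact: clK.
      by move=> _; apply: zA.
    by move=> _; rewrite adjC; apply: zA.
  by have := small _ clz; rewrite cardsU1 zK add1n ltnS leqNgt mK.
have fK z : f z \in K by case: (fP z).
pose g z : {x | x \in K} := Sub (f z) (fK z).
apply: (uncolorable (D := {x | x \in K}) (f := g)); first by rewrite card_sig; apply: small.
move=> u v _ _ uv; apply: contraTneq uv => /(congr1 val) /= fuv.
have [uK|uK] := boolP (u \in K); have [vK|vK] := boolP (v \in K).
- by move: fuv; rewrite /f uK vK => ->; rewrite adj_irrefl.
- by have [_ /(_ vK)] := fP v; rewrite -fuv {1}/f uK adjC.
- by have [_ /(_ uK)] := fP u; rewrite fuv {1}/f vK.
- by apply/negP => /(clique_meets_edge clK mK); rewrite (negbTE uK) (negbTE vK).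
Qed.

(** Let [w] miss [y] and delete the edge [xw]. The colour of [y] occurs on a common neighbour of [x]
    and [w]; it is not [y], and having the same colour it also misses [y]. *)
Lemma nonnbr_ge2 x y : adj x y -> nonnbr x y != set0 -> 1 < #|nonnbr x y|.
Proof.
move=> xy /set0Pn[w wN]; have /nonnbrP[xw wy yw] := wN.
have [c cf] := edge_config xw.
have [||||v [/clsP[xv vT cv] /clsP[wv _ _]]] :=
  kempe1 uncolorable cf (x := x) (y := w) (i := c y); rewrite ?in_setT ?set21 ?set22 //.
  exact: adj_neq.
have vy : v != y by apply: contraNneq yw => <-; rewrite adjC.
apply/card_gt1P; exists w, v; split=> //; last exact: adj_neq.
apply/nonnbrP; split=> //; have [_ pr _ _] := cf.
apply/negP => yv; have := pr y v; rewrite cv eqxx yv => H; apply: (negP (H _ _ isT)) => //.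
by rewrite !inE negb_or !(eq_sym y) wy (adj_neq xy).
Qed.

(** Each of the [m] colours occurs on a common neighbour of [x] and [y]; the strict inequality
    accounts for [y] itself. *)
Lemma card_nonnbr x y : adj x y -> #|nonnbr x y| + m < #|nbr x|.
Proof.
move=> xy; have [c cf] := edge_config xy.
have common : m <= #|nbr x :&: nbr y|.
  rewrite -[m in m <= _]card_ord -cardsT.
  apply: leq_trans (leq_imset_card c _); apply/subset_leq_card/subsetP => i _.
  have [||||v [/clsP[xv _ cv] /clsP[yv _ _]]] :=
    kempe1 uncolorable cf (x := x) (y := y) (i := i); rewrite ?in_setT ?set21 ?set22 //.
    exact: adj_neq.
  by apply/imsetP; exists v; rewrite ?inE ?xv.
rewrite -(cardsID (nbr y) (nbr x)) addnC -addnS; apply: leq_add => //.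
rewrite (cardsD1 y (_ :\: _)) !inE adj_irrefl xy ltnS; apply/subset_leq_card/subsetP => w.
by case/nonnbrP => xw wy yw; rewrite !inE wy yw xw.
Qed.

Lemma exists_nonnbr x : exists2 y, adj x y & nonnbr x y != set0.
Proof.
have [/existsP[y /andP[]]|no] := boolP [exists y, adj x y && (nonnbr x y != set0)].
  by exists y.
have cl : clique (x |: nbr x).
  move=> u v /setU1P[->|xu] /setU1P[->|xv] uv.
  - by rewrite eqxx in uv.
  - by rewrite inE in xv.
  - by rewrite inE in xu; rewrite adjC.
  - rewrite !inE in xu xv; apply: contraNT no => nuv; apply/existsP; exists u; rewrite xu.
    by apply/set0Pn; exists v; apply/nonnbrP; rewrite eq_sym.
have := clique_card cl; rewrite cardsU1 inE adj_irrefl /= add1n.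
have [y xy] := no_isolated x; have := card_nonnbr xy; lia.
Qed.

Lemma min_degree x : m + 3 <= #|nbr x|.
Proof.
have [y xy /(nonnbr_ge2 xy) N2] := exists_nonnbr x; have := card_nonnbr xy.
by apply: leq_trans; rewrite addnC -addSn leq_add2r.
Qed.

(* The witness edge avoids the closed neighbourhood of [x]: if there were none,
   a nonneighbour [v] of [x] would have [N(v)] inside [N(x)], and colouring [v]
   like [x] would save a colour. *)
Lemma far_edge_coloring x : ~~ universal x ->
  exists c y z, [/\ proper_off [set y; z] c, x \notin [set y; z] & nbr x :&: [set y; z] = set0].
Proof.
case/forallPn => v; rewrite negb_imply => /andP[vx xv].
have [/existsP[y /existsP[z /and3P[yz]]]|no] := boolP [exists y, [exists z,
    [&& adj y z, (y != x) && (z != x) & ~~ adj x y && ~~ adj x z]]].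
  move=> /andP[yx zx] /andP[xy xz]; have [c pr] := edge_colorable yz; exists c, y, z.
  split=> //; first by rewrite !inE negb_or !(eq_sym x) yx zx.
  apply/setP => w; rewrite !inE; apply/negbTE; apply: contraL xy => /andP[xw /orP[]/eqP E].
    by rewrite -E negbK.
  by rewrite -E xw in xz.
exfalso; have Nv w : adj v w -> adj x w.
  move=> vw; apply: contraNT no => xw; apply/existsP; exists v; apply/existsP; exists w.
  rewrite vw vx xv xw /= andbT; apply: contraNneq xv => <-; by rewrite adjC.
have [z vz] := no_isolated v; have [c pr] := edge_colorable vz.
have xz : x != z by apply: contraNneq xv => ->; rewrite adjC.
apply: (@uncolorable (option 'I_m)
    (recolor (recolor (Some \o c) [set z] None) [set v] (Some (c x)))).
  by rewrite card_option card_ord.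
have -> : set0 = [set v; z] :\: [set z] :\: [set v] :> {set G}.
  by apply/esym/setP => w; rewrite !inE; case: eqP => //= _; case: eqP.
apply: recolor_proper; first apply: recolor_proper.
- by move=> u w uT wT uw; apply: contra_neq (pr _ _ uT wT uw) => -[].
- by move=> u w /set1P-> /set1P->; rewrite adj_irrefl.
- by [].
- by move=> u w /set1P-> /set1P->; rewrite adj_irrefl.
- move=> u w /set1P-> _; rewrite /recolor !in_set1 => wv.
  case: ifP => // /negbT wz [cw]; apply/negP => /Nv xw.
  have : c x != c w.
    apply: pr => //; rewrite !inE negb_or; last by rewrite wv wz.
    by rewrite eq_sym vx xz.
  by rewrite cw eqxx.
Qed.

(* In the colouring of the previous lemma the colour of [x] is absent from
   [N(x)], each other class has at most two vertices of [N(x)], and only one if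
   it contains a vertex adjacent to all the others. *)
Lemma max_degree x : ~~ universal x ->
  #|nbr x| + #|[set v in nbr x | nonnbr x v == set0]| <= 2 * m.-1.
Proof.
move=> /far_edge_coloring[c [y [z [pr xT NT]]]].
have off v : adj x v -> v \notin [set y; z].
  by move=> xv; apply/negP => vT; have := in_set0 v; rewrite -NT inE vT inE xv.
set I := [set v in nbr x | _].
have split_color (A : {set G}) : A \subset nbr x ->
    #|A| = \sum_(i in ~: [set c x]) #|[set v in A | c v == i]|.
  move=> /subsetP AN; rewrite -sum1_card (partition_big c (mem (~: [set c x]))) /=; last first.
    move=> v /AN; rewrite !inE => xv; rewrite eq_sym; apply: pr => //; exact: off.
  apply: eq_bigr => i _; rewrite sum1_card; apply: eq_card => v.
  by rewrite !inE.
have IN : I \subset nbr x by apply/subsetP => v; rewrite inE => /andP[].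
rewrite (split_color _ (subxx _)) (split_color _ IN) -big_split /=.
have -> : 2 * m.-1 = \sum_(i in ~: [set c x]) 2.
  by rewrite sum_nat_const cardsC1 card_ord mulnC.
apply: leq_sum => i _.
have nonadj u v : c u = i -> c v = i -> adj x u -> adj x v -> adj u v = false.
  move=> cu cv xu xv; apply/negP => /(pr _ _ (off u xu) (off v xv)).
  by rewrite cu cv eqxx.
have [->|/set0Pn[v]] := eqVneq [set v in I | c v == i] set0.
  rewrite cards0 addn0 leqNgt; apply/negP => /card_gt2P[p [q [r [[]]]]].
  rewrite !inE => /andP[xp /eqP cp] /andP[xq /eqP cq] /andP[xr /eqP cr] [pq qr rp].
  have := claw xp xq xr pq; rewrite eq_sym rp qr => /(_ isT isT).
  by rewrite (nonadj _ _ cp cq xp xq) (nonadj _ _ cp cr xp xr) (nonadj _ _ cq cr xq xr).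
rewrite !inE => /andP[/andP[xv /eqP Iv] /eqP cv].
have -> : [set v in nbr x | c v == i] = [set v].
  apply/setP => w; rewrite !inE; have [->|wv] := eqVneq w v; first by rewrite xv cv eqxx.
  apply/negP => /andP[xw /eqP cw]; have := in_set0 w; rewrite -Iv => /nonnbrP[].
  by rewrite xw wv (nonadj v w).
rewrite cards1 add1n ltnS -(cards1 v); apply/subset_leq_card/subsetP => w.
rewrite !inE => /andP[/andP[xw _] /eqP cw]; apply: contraT => wv.
have := in_set0 w; rewrite -Iv => /nonnbrP[].
by rewrite xw wv (nonadj v w).
Qed.


(** If d(x) = m + 3, each neighbour of [x] misses at most two others, at most one misses none, and
    only two classes are not single for [x]. In a class single for both [x] and [y] the single
    neighbour is shown to miss none, so at most one class is shared. This forces m = 6 and leaves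
    three classes single for [x] alone, whose single neighbours are the leaves of a claw. *)
Lemma degree_neq x : 5 <= m <= 6 -> ~~ universal x -> #|nbr x| != m + 3.
Proof.
move=> m56 x_nu; apply/eqP => dx.
have := max_degree x_nu; set I := [set v in nbr x | _]; rewrite dx => iso.
have I_le : #|I| + 5 <= m by lia.
have I1 : #|I| <= 1 by lia.
have le2 w : adj x w -> #|nonnbr x w| <= 2 by move=> /card_nonnbr; lia.
have [y xy yN] := exists_nonnbr x; have xNy := adj_neq xy.
have [c cf] := edge_config xy; set T := [set x; y] in cf.
have [xT yT] : x \in T /\ y \in T by rewrite set21 set22.
have y_nu : ~~ universal y.
  case/set0Pn: yN => w /nonnbrP[_ wy yw]; apply/forallPn; exists w.
  by rewrite wy.
pose Px := singles T c setT x; pose Py := singles T c setT y.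
have cardPx : #|Px| + 2 = m.
  have := card_singles uncolorable claw cf xT.
  by rewrite -/Px dx cardsT card_ord cards2 xNy; lia.
have cardPy : 3 <= #|Py|.
  have := card_singles uncolorable claw cf yT; have := max_degree y_nu.
  by rewrite -/Py cardsT card_ord cards2 xNy; lia.
have cardD : #|~: Px| = 2 by have := cardsC Px; rewrite card_ord; lia.
have /cards2P[d1 [d2 [d12 DE]]] : #|~: Px| == 2 by rewrite cardD.
have pair_d1 v1 v2 k1 k2 : k1 \notin Px -> k2 \notin Px -> k1 != k2 ->
    v1 \in cls T c x k1 -> v2 \in cls T c x k2 -> (v1 \in cls T c x d1) || (v2 \in cls T c x
        d1).
  rewrite -!in_setC DE => /set2P[]-> /set2P[]->; rewrite ?eqxx //.
    by move=> _ -> .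
  by move=> _ _ ->; rewrite orbT.
have cls_ne v k t : v \in cls T c x k -> t \in T -> t != v.
  by move=> /clsP[_ vT _] tT; apply: contraNneq vT => <-.
have cls_nc v v' k k' : v \in cls T c x k -> v' \in cls T c x k' -> k != k' -> v != v'.
  by move=> /clsP[_ _ cv] /clsP[_ _ cv']; apply: contra_neq => E; rewrite -cv -cv' E.
have over v (s : seq G) : adj x v -> uniq s -> all (fun w => w \in nonnbr x v) s -> size s <= 2.
  by move=> xv us /allP sN; apply: leq_trans (size_uniq_leq_card us sN) (le2 v xv).
have [b bN bX] : exists2 b, b \in nonnbr x y & b \in cls T c x d1.
  have /card_gt1P[b [b' [bN b'N bb']]] := nonnbr_ge2 xy yN.
  have [k _ bX] := nonnbr_cls cf xT yT bN; have [k' _ b'X] := nonnbr_cls cf xT yT b'N.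
  have kx t l : t \in nonnbr x y -> t \in cls T c x l -> l \notin Px.
    by case/nonnbrP => _ _ yt tX; move: (single_of_not_adj uncolorable cf xT yT (in_setT _) tX
        yt).
  have kk' : k != k'.
    apply: contraNneq bb' => E; rewrite -E in b'X; apply/eqP.
    exact: (nonnbr_cls_inj uncolorable claw cf xT yT xNy (in_setT k) bN b'N bX b'X).
  by case/orP: (pair_d1 _ _ _ _ (kx _ _ bN bX) (kx _ _ b'N b'X) kk' bX b'X);
      [exists b|exists b'].
pose r k := odflt x [pick v in cls T c x k].
have rP k : r k \in cls T c x k.
  rewrite /r; case: pickP => //= no; have := cls_gt0 uncolorable cf xT (in_setT k).
  by rewrite (eq_card0 no).
have cr k : c (r k) = k by case/clsP: (rP k).
have xr k : adj x (r k) by case/clsP: (rP k).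
have yr k : k \in Px -> adj y (r k).
  by move=> kx; case/clsP: (single_common uncolorable cf xT yT kx (rP k)).
(* If [v] missed [y], it would miss [y], its mate and [r j], more than the two allowed. *)
have r_cls j v : j \in Px -> v \in nonnbr x (r j) -> exists2 k, v \in cls T c x k & adj y v.
  move=> jx vN; have /nonnbrP[xv vr rv] := vN.
  have vT : v \notin T.
    apply: contraNN rv => /set2P[]->; rewrite adjC ?yr //.
  have [_ vX] := mem_nbr cf xT xv vT; exists (c v) => //; apply: contraT => yv.
  have kx := single_of_not_adj uncolorable cf xT yT (in_setT _) vX yv.
  have [u uX uv] := not_single cf (in_setT _) kx vX.
  have cj : c v != j by apply: contraNneq kx => ->.
  have := @over v [:: y; u; r j] xv; rewrite /= !in_cons !in_nil !orbF !negb_or.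
  rewrite (cls_ne _ _ _ uX yT) (cls_ne _ _ _ (rP j) yT) (cls_nc _ _ _ _ uX (rP j) cj).
  rewrite (nonnbr_sym (xr j) vN) (cls_mate cf vX uX uv) /= andbT.
  suff -> : y \in nonnbr x v by move=> /(_ isT isT).
  by apply/nonnbrP; split=> //; [apply: cls_ne vX yT|rewrite adjC].
have iso_le (J : {set 'I_m}) : J \subset Px -> (forall j, j \in J -> nonnbr x (r j) = set0) ->
    #|J| <= #|I|.
  move=> JP J0; have rinj : {in J &, injective r}.
    by move=> j k _ _ E; rewrite -(cr j) E cr.
  have <- : #|r @: J| = #|J| by apply: card_in_imset.
  apply/subset_leq_card/subsetP => v /imsetP[j jJ ->].
  by rewrite !inE xr J0 ?eqxx.
(* By [single_link], the vertices missing [r j] lie in classes single for neither end. Two of them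
   are in different classes, which are then all the classes outside [Px]. *)
have noniso j : j \in Px -> j \in Py -> nonnbr x (r j) != set0 ->
    (exists2 v, v \in nonnbr x (r j) & v \in cls T c x d1 /\ adj y v) /\ Py \subset Px.
  move=> jx jy rN; have rX := rP j; have rY := single_common uncolorable cf xT yT jx rX.
  have col v k : v \in nonnbr x (r j) -> v \in cls T c x k -> adj y v -> k \notin Px /\ k
      \notin Py.
    move=> /nonnbrP[xv vr rv] vX yv; have kj : k != j.
      by apply: contraNneq vr => E; rewrite E in vX; apply/eqP/(single_eq jx vX rX).
    have vY := mem_cls_of_adj yT vX yv.
    split; apply: contraNN rv => kP; rewrite adjC.
      by move: (single_link uncolorable cf xT yT xNy kj kP jy vX rY).
    have yNx : y != x by rewrite eq_sym.
    by move: (single_link uncolorable cf yT xT yNx kj kP jx vY rX).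
  have /card_gt1P[v1 [v2 [v1N v2N v12]]] := nonnbr_ge2 (xr j) rN.
  have [k1 v1X yv1] := r_cls j v1 jx v1N; have [k2 v2X yv2] := r_cls j v2 jx v2N.
  have [k1x k1y] := col _ _ v1N v1X yv1; have [k2x k2y] := col _ _ v2N v2X yv2.
  have k12 : k1 != k2.
    apply/eqP => E; rewrite -E in v2X; apply: (nonnbr_triangle claw (xr j) v1N v2N).
    by apply: cls_mate cf v1X v2X _; rewrite eq_sym.
  split.
    by case/orP: (pair_d1 _ _ _ _ k1x k2x k12 v1X v2X) => ?; [exists v1|exists v2].
  have D12 : ~: Px = [set k1; k2] by apply: set2_eq (eq_leq cardD); rewrite ?in_setC.
  apply/subsetP => k ky; rewrite -[k \in Px]negbK -in_setC D12 !inE negb_or.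
  by apply/andP; split; [apply: contraNneq k1y|apply: contraNneq k2y] => <-.
(* Both [r j] and [r k] would be missed by the neighbour of [x] in class [d1] adjacent to [y], which
   also misses [b]. *)
have noniso_eq j k : j \in Px -> j \in Py -> k \in Px -> k \in Py ->
    nonnbr x (r j) != set0 -> nonnbr x (r k) != set0 -> j = k.
  move=> jx jy kx ky jN kN; apply/eqP; apply: contraT => jk.
  have [[v vN [vX yv]] _] := noniso j jx jy jN; have [[w wN [wX yw]] _] := noniso k kx ky kN.
  have /nonnbrP[xb _ yb] := bN.
  have vb : v != b by apply: contraNneq yb => <-.
  have wE : w = v.
    by case: (cls_two claw cf vX bX vb wX) => // E; rewrite -E yw in yb.
  have xv : adj x v by case/clsP: vX.
  have := @over v [:: b; r j; r k] xv; rewrite /= !in_cons !in_nil !orbF !negb_or.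
  have d1x : d1 \notin Px by rewrite -in_setC DE set21.
  rewrite (cls_nc _ _ _ _ (rP j) (rP k) jk).
  rewrite (cls_nc _ _ _ _ bX (rP j)) 1?(cls_nc _ _ _ _ bX (rP k)); first last.
  - by apply: contraNneq d1x => ->.
  - by apply: contraNneq d1x => ->.
  rewrite wE in wN; rewrite (nonnbr_sym (xr j) vN) (nonnbr_sym (xr k) wN).
  by rewrite (cls_mate cf vX bX) 1?eq_sym // => /(_ isT isT).
have cardJ := cardsID Px Py; have cardE := cardsID Py Px.
have DPy : #|Py :\: Px| <= 2.
  by rewrite -cardD; apply/subset_leq_card/subsetP => k; rewrite !inE => /andP[].
have all_iso j : j \in Py :&: Px -> nonnbr x (r j) = set0.
  rewrite inE => /andP[jy jx]; apply/eqP; apply: contraT => jN.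
  have [_ sub] := noniso j jx jy jN.
  have : #|Py :\ j| <= #|I|.
    apply: iso_le; first by apply: subset_trans sub; apply: subD1set.
    move=> k /setD1P[kj ky]; apply/eqP; apply: contraNT kj => kN; apply/eqP.
    by apply: noniso_eq; rewrite // (subsetP sub).
  move: cardPy; rewrite (cardsD1 j Py) jy ltnS => le2' leI.
  by have := leq_trans le2' (leq_trans leI I1).
have J1 : #|Py :&: Px| <= #|I| by apply: iso_le => //; apply: subsetIr.
(* There is no slack in 3 <= [#|Py|] <= 2 + [#|I|], and [#|I|] = 1 needs m >= 6. *)
have [D2 J1' m6] : [/\ #|Py :\: Px| = 2, #|Py :&: Px| = 1 & m = 6].
  move: cardJ cardPy DPy J1 I1 I_le; case/andP: m56 => _.
  by move: #|Py :&: Px| #|Py :\: Px| #|Py| #|I|; clear; split; lia.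
have cardE3 : #|Px :\: Py| = 3.
  move: cardE cardPx m6; rewrite setIC J1'.
  by move: #|Px :\: Py| #|Px|; clear; lia.
have /card_gt0P[j0 j0J] : 0 < #|Py :&: Px| by rewrite J1'.
have DPyE : Py :\: Px = ~: Px.
  apply/eqP; rewrite eqEcard cardD D2 leqnn andbT.
  by apply/subsetP => k; rewrite !inE => /andP[].
have EN k : k \in Px :\: Py -> nonnbr x (r k) = r @: ((Px :\: Py) :\ k).
  move=> /setDP[kx ky]; apply/eqP; rewrite eqEcard.
  have rN : nonnbr x (r k) != set0.
    apply: contraL I1 => /eqP k0; rewrite -ltnNge.
    have j0k : j0 != k by apply: contraNneq ky => <-; case/setIP: j0J.
    have <- : #|[set j0; k]| = 2 by rewrite cards2 j0k.
    apply: iso_le; first by rewrite subUset !sub1set kx andbT; case/setIP: j0J.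
    by move=> j /set2P[]-> //; apply: all_iso.
  apply/andP; split.
    apply/subsetP => v vN; have [l vX yv] := r_cls k v kx vN; have /nonnbrP[xv vr rv] := vN.
    have lk : l != k.
      by apply: contraNneq vr => E; rewrite E in vX; apply/eqP/(single_eq kx vX (rP k)).
    have ly : l \notin Py.
      apply: contraNN rv => ly.
      have kl : k != l by rewrite eq_sym.
      by move: (single_link uncolorable cf xT yT xNy kl kx ly (rP k) (mem_cls_of_adj yT vX yv)).
    have lx : l \in Px.
      by rewrite -[l \in Px]negbK -in_setC -DPyE inE (negbTE ly) andbF.
    apply/imsetP; exists l; first by rewrite in_setD1 in_setD lk ly.
    exact: single_eq lx vX (rP l).
  apply: leq_trans (leq_imset_card _ _) _; apply: leq_trans (nonnbr_ge2 (xr k) rN).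
  by move: cardE3; rewrite (cardsD1 k) in_setD kx ky add1n => -[->].
have /card_gt2P[k1 [k2 [k3 [[E1 E2 E3] [k12 k23 k31]]]]] : 2 < #|Px :\: Py| by rewrite cardE3.
have memN k l : k \in Px :\: Py -> l \in Px :\: Py -> l != k -> r l \in nonnbr x (r k).
  by move=> kE lE lk; rewrite EN //; apply: imset_f; rewrite in_setD1 lk.
apply: (nonnbr_triangle claw (xr k1) (memN k1 k2 E1 E2 _) (memN k1 k3 E1 E3 k31)).
  by rewrite eq_sym.
by apply: memN; rewrite // eq_sym.
Qed.

(** * Consequences of the degree bounds *)

Lemma exists_not_universal : exists x, ~~ universal x.
Proof.
have [x [y [xy nxy]]] := incomplete; exists x.
by apply/forallPn; exists y; rewrite eq_sym xy.
Qed.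

(** The bounds m + 3 <= d(x) <= 2m - 2 give m >= 5, and for m = 5 they leave only the excluded
    degree m + 3. *)
Lemma incomplete_ge6 : 4 <= m -> 6 <= m.
Proof.
move=> m4; have [x x_nu] := exists_not_universal.
have dmin := min_degree x; have dmax := max_degree x_nu.
have m5 : 5 <= m by lia.
rewrite ltn_neqAle m5 andbT; apply/eqP => m5E.
have m56 : 5 <= m <= 6 by rewrite -m5E.
by have /eqP := degree_neq m56 x_nu; lia.
Qed.

Lemma degree10 x : m = 6 -> ~~ universal x ->
  #|nbr x| = 10 /\ forall v, adj x v -> nonnbr x v != set0.
Proof.
move=> m6 x_nu; have dmin := min_degree x; have m56 : 5 <= m <= 6 by rewrite m6.
have := max_degree x_nu; set I := [set v in nbr x | _] => dmax.
have [d10 I0] : #|nbr x| = 10 /\ #|I| = 0.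
  have := degree_neq m56 x_nu; move: m6 dmin dmax.
  by move: #|nbr x| #|I|; clear => d i -> ? ? /eqP; lia.
split=> // v xv; apply: contra_eq_neq I0 => v0; rewrite -lt0n.
by apply/card_gt0P; exists v; rewrite !inE xv v0 eqxx.
Qed.

(** A universal vertex would miss nothing in the neighbourhood of a vertex that is not universal,
    against [degree10]. *)
Lemma all_not_universal x : m = 6 -> ~~ universal x.
Proof.
move=> m6; apply/negP => /forallP xu; have [z z_nu] := exists_not_universal.
have xP v : v != x -> adj x v by have := xu v; case: eqP.
have zx : z != x by apply: contraNneq z_nu => ->; apply/forallP.
have [_ noniso] := degree10 m6 z_nu; have zx' : adj z x by rewrite adjC xP.
have /set0Pn[w /nonnbrP[_ wx]] := noniso x zx'.
by rewrite xP.
Qed.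

Lemma degree_regular : m = 6 ->
  (forall x, #|nbr x| = 10) /\ (forall x y, adj x y -> 1 < #|nonnbr x y| <= 3).
Proof.
move=> m6; have deg x := degree10 m6 (all_not_universal x m6).
split=> [x|x y xy]; have [dx noniso] := deg x; first by [].
rewrite nonnbr_ge2 ?noniso //=.
by have := card_nonnbr xy; rewrite dx; lia.
Qed.

End Critical.

(** * From double-critical graphs to colourings *)

Lemma complete_of_critical (G : sgraph) m : 4 <= m <= 6 ->
  (forall (D : finType) (f : G -> D), #|D| <= m.+1 -> ~ proper_off set0 f) ->
  (forall x y : G, adj x y -> exists c : G -> 'I_m, proper_off [set x; y] c) ->
  no_claw G -> (forall x : G, exists y, adj x y) ->
  forall x y : G, x != y -> adj x y.
Proof.
move=> /andP[m4 m6] unc ec claw conn x y xy; apply: contraT => nxy.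
have inc : exists x y : G, x != y /\ ~~ adj x y by exists x, y.
have Em : m = 6 by have := incomplete_ge6 unc ec claw conn inc m4; lia.
subst m; have [z xz] := conn x; have [c cf] := edge_config ec xz.
have [reg bounds] := degree_regular unc ec claw conn inc (erefl 6).
have noK7 (K : {set G}) : clique K -> #|K| <= 6 := @clique_card _ _ unc ec conn inc K.
case: (config2_false unc claw reg bounds noK7 cf).
by rewrite cards2 adj_neq.
Qed.

Lemma colorable_proper (G : sgraph) k (D : finType) (f : G -> D) :
  #|D| <= k -> proper_off set0 f -> colorable G k.
Proof.
move=> Dk pr; apply/existsP; exists [ffun x => widen_ord Dk (enum_rank (f x))].
apply/forallP => x; apply/forallP => y; apply/implyP => xy; rewrite !ffunE.
have := pr x y; rewrite !inE => /(_ isT isT xy); apply: contra_neq => E.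
by apply: enum_rank_inj; apply: val_inj; apply: (congr1 val E).
Qed.

Lemma colorable_chromatic (G : sgraph) : colorable G (chromatic_number G).
Proof. by rewrite /chromatic_number; case: ex_minnP. Qed.

Lemma chromatic_le (G : sgraph) k : colorable G k -> chromatic_number G <= k.
Proof. by rewrite /chromatic_number; case: ex_minnP => n _; apply. Qed.

Lemma delete_coloring (G : sgraph) (A : {set G}) m :
  colorable (delete A) m -> 0 < m -> exists c : G -> 'I_m, proper_off A c.
Proof.
move=> /existsP[c /forallP cP] m0.
(* Deleted vertices get a default colour, which exists because [m] is positive. *)
exists (fun v => if insub v is Some s then c s else Ordinal m0) => u v uA vA uv.
have [uA' vA'] : u \in ~: A /\ v \in ~: A by rewrite !inE.
rewrite (insubT (mem (~: A)) uA') (insubT (mem (~: A)) vA').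
by have /forallP/(_ (Sub v vA'))/implyP := cP (Sub u uA'); apply.
Qed.

Lemma claw_free_no_claw (G : sgraph) : claw_free G -> no_claw G.
Proof.
move=> cf x a b c xa xb xc ab ac bc; apply: contraT.
rewrite !negb_or => /and3P[nab nac nbc]; case: cf.
pose A := [set x; a; b; c]; exists A.
have lA (i : 'I_3) : nth x [:: a; b; c] i \in A.
  by case: i => [[|[|[|//]]] ?]; rewrite /= !inE eqxx ?orbT.
have xA : x \in A by rewrite !inE eqxx.
pose g (p : 'I_1 + 'I_3) : {v | v \in A} :=
  match p with inl _ => Sub x xA | inr i => Sub (nth x [:: a; b; c] i) (lA i) end.
have xt (i : 'I_3) : adj x (nth x [:: a; b; c] i) by case: i => [[|[|[|//]]] ?].
have tt (i j : 'I_3) : adj (nth x [:: a; b; c] i) (nth x [:: a; b; c] j) = false.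
  by case: i => [[|[|[|//]]] ?]; case: j => [[|[|[|//]]] ?]; rewrite /= ?adj_irrefl //;
    apply/negbTE; rewrite // adjC.
have t_inj (i j : 'I_3) : nth x [:: a; b; c] i = nth x [:: a; b; c] j -> i = j.
  by case: i => [[|[|[|//]]] ?]; case: j => [[|[|[|//]]] ?] //= E;
    apply: val_inj => //; move: ab ac bc; rewrite E ?eqxx.
have g_adj p q : induced_adj (g p) (g q) = adj (p : complete_bipartite 1 3) q.
  rewrite /induced_adj; case: p => [i|i]; case: q => [j|j] /=.
  - by rewrite adj_irrefl.
  - by rewrite xt.
  - by rewrite adjC xt.
  - by rewrite tt.
have g_inj : injective g.
  move=> [i|i] [j|j] /(congr1 val) //= E.
  - by rewrite !ord1.
  - by have := xt j; rewrite -E adj_irrefl.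
  - by have := xt i; rewrite E adj_irrefl.
  - by rewrite (t_inj _ _ E).
have [f gK fK] : bijective g.
  apply: inj_card_bij g_inj _; rewrite card_sig card_sum !card_ord.
  apply: leq_trans (_ : size [:: x; a; b; c] <= _) => //.
  apply: leq_trans (card_size [:: x; a; b; c]); apply/subset_leq_card/subsetP => v.
  by rewrite !inE -!orbA.
exists f; first by exists g.
by move=> u v; rewrite -{2}(fK u) -{2}(fK v) -g_adj.
Qed.

Theorem theorem1p6 (G : sgraph) (t : nat) :
  t \in [:: 6; 7; 8] ->
  double_critical G -> chromatic_number G = t ->
  claw_free G -> isomorphic G (complete_graph t).
Proof.
move=> tE [conn crit] chi /claw_free_no_claw claw.
have [m m46 Et] : exists2 m, 4 <= m <= 6 & t = m.+2.
  by exists t.-2; move: tE; rewrite !inE => /or3P[]/eqP->.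
have unc (D : finType) (f : G -> D) : #|D| <= m.+1 -> ~ proper_off set0 f.
  move=> Dm pr; have := chromatic_le (colorable_proper Dm pr).
  by rewrite chi Et ltnn.
have ec x y : adj x y -> exists c : G -> 'I_m, proper_off [set x; y] c.
  move=> xy; apply: delete_coloring; last by case/andP: m46; case: (m).
  have := crit x y xy; rewrite chi Et addn2 => -[<-].
  exact: colorable_chromatic.
(* Colouring every vertex by itself shows that there are at least t vertices; connectedness then
   gives each vertex a neighbour. *)
have card_ge : m.+1 < #|G|.
  rewrite ltnNge; apply/negP => Gm; apply: (unc G id Gm) => u v _ _; exact: adj_neq.
have nb (x : G) : exists y, adj x y.
  have /card_gt0P[y] : 0 < #|[set~ x]| by rewrite cardsC1; case: #|G| card_ge => [|[]].
  rewrite !inE => yx; have /connectP[[|z p] /= path_p E] := conn x y.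
    by rewrite E eqxx in yx.
  by exists z; case/andP: path_p.
have complete := complete_of_critical m46 unc ec claw nb.
have Gt : #|G| = t.
  apply/eqP; rewrite eqn_leq -{2}chi chromatic_le ?andbT; last first.
    by apply: (@colorable_proper _ _ G id) => // u v _ _; apply: adj_neq.
  have /existsP[c /forallP cP] := colorable_chromatic G; rewrite chi in c cP.
  have c_inj : injective c.
    move=> u v cuv; apply/eqP; apply: contraT => /complete uv.
    by have /forallP/(_ v)/implyP/(_ uv) := cP u; rewrite cuv eqxx.
  by have := leq_card c c_inj; rewrite card_ord.
exists (fun x => cast_ord Gt (enum_rank x)).
  exists (fun i => enum_val (cast_ord (esym Gt) i)) => [x|i].
    by rewrite cast_ordK enum_rankK.
  by rewrite enum_valK cast_ordKV.
move=> x y; rewrite [LHS](_ : _ = (x != y)); last first.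
  by rewrite /adj /= /complete_adj (inj_eq (@cast_ord_inj _ _ Gt)) (inj_eq enum_rank_inj).
by have [->|/complete xy] := eqVneq x y; [rewrite adj_irrefl | rewrite xy].
Qed.
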